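(* Let $\mathcal{L}=\sum_{k=1}^{n}\lambda_k\mathcal{L}_k$ be a generator as described in the context, with $\Gamma=\sum_{k=1}^n\lambda_k>0$, and let $t\ge 0$. Let $r$ be a positive integer such that $r\Gamma$ is a positive integer. Then $$\big\|\Lambda(t)-\mathcal{E}(t/r)^{r\Gamma}\big\|_{\diamond}\;\le\;\frac{t^{2}\sum_{k=1}^{n}\lambda_{k}\|\mathcal{L}_{k}\|_{\diamond}^{2}}{r}.$$ In particular, for any $\epsilon>0$, if $$r\;\ge\;\left\lceil \frac{t^{2}}{\epsilon}\sum_{k=1}^{n}\lambda_{k}\|\mathcal{L}_{k}\|_{\diamond}^{2}\right\rceil$$ (and $r\Gamma$ is an integer), then $\|\Lambda(t)-\mathcal{E}(t/r)^{r\Gamma}\|_{\diamond}\le\epsilon$.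
   Context: Work on $d\times d$ complex matrices. A superoperator is a linear map on $d\times d$ matrices; its diamond norm is $\|\Phi\|_\diamond=\sup\{\|(\Phi\otimes\mathrm{id}_d)(X)\|_1:\|X\|_1\le 1\}$, where $\|\cdot\|_1$ is the trace norm. The generator is $\mathcal{L}=\sum_{k=1}^{n}\lambda_k\mathcal{L}_k$ with $\lambda_k\ge 0$, where each term $\mathcal{L}_k$ is either a Hamiltonian term $\mathcal{L}_k(\rho)=-i[H_k,\rho]$ with $H_k$ Hermitian, or a dissipative term $\mathcal{L}_k(\rho)=L_k\rho L_k^\dagger-\tfrac12\{L_k^\dagger L_k,\rho\}$ with $L_k$ a $d\times d$ matrix; in either case $e^{s\mathcal{L}_k}$ is completely positive and trace preserving (CPTP) for all $s\ge 0$, and so is $e^{s\mathcal{L}}$. Define $\Lambda(t)=\exp(t\mathcal{L})$, $\Gamma=\sum_{k=1}^n\lambda_k$, $p_k=\lambda_k/\Gamma$, and the qDRIFT channel $\mathcal{E}(\tau)=\sum_{k=1}^{n}p_k\exp(\tau\mathcal{L}_k)$ for $\tau\ge 0$. Powers of superoperators denote repeated composition. *)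

(* Defs.v *)
From HB Require Import structures.
From mathcomp Require Import all_boot all_order all_algebra.
From mathcomp Require Import all_classical all_reals all_analysis.
From mathcomp Require Import complex mxtens.
Set Implicit Arguments.
Unset Strict Implicit.
Unset Printing Implicit Defensive.
Import Order.TTheory GRing.Theory Num.Theory.
Import numFieldNormedType.Exports.
Local Open Scope classical_set_scope.
Local Open Scope ring_scope.
Local Open Scope complex_scope.

Section Defs.
Variable R : realType.
Variable d : nat.
Notation C := R[i].

Definition adjmx m n (A : 'M[C]_(m, n)) : 'M[C]_(n, m) := (map_mx Num.conj A)^T.

Definition hermitian (H : 'M[C]_d) : Prop := adjmx H = H.

Definition psd m (A : 'M[C]_m) : Prop :=
  adjmx A = A /\ forall v : 'cV[C]_m, 0 <= (adjmx v *m A *m v) 0 0.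

Definition psdsqrt m (A : 'M[C]_m) : 'M[C]_m :=
  xget 0 [set S : 'M[C]_m | psd S /\ S *m S = A].

Definition trnorm m (X : 'M[C]_m) : R := complex.Re (\tr (psdsqrt (adjmx X *m X))).

Definition superop := 'M[C]_d -> 'M[C]_d.

(* (Phi (x) id_d)(X) for X in M_d (x) M_d, Phi acting on the first factor *)
Definition tens_id (Phi : superop) (X : 'M[C]_(d * d)) : 'M[C]_(d * d) :=
  \sum_(c < d) \sum_(e < d)
     Phi (\matrix_(i, j) X (mxtens_index (i, c)) (mxtens_index (j, e)))
       *t (delta_mx c e : 'M[C]_d).

Definition dnorm (Phi : superop) : R :=
  sup [set trnorm (tens_id Phi X) | X in [set X : 'M[C]_(d * d) | trnorm X <= 1]].

Definition sexp (L : superop) : superop := fun X =>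
  lim ((fun N : nat => \sum_(k < N) (k`!%:R)^-1 *: iter k L X) @ \oo).

Definition sscale (t : R) (L : superop) : superop := fun X => t%:C *: L X.
Definition ssub (A B : superop) : superop := fun X => A X - B X.

Inductive lterm := Ham of 'M[C]_d | Diss of 'M[C]_d.

Definition lterm_ok (T : lterm) : Prop :=
  match T with Ham H => hermitian H | Diss _ => True end.

Definition lterm_op (T : lterm) : superop :=
  match T with
  | Ham H => fun rho => (- 'i) *: (H *m rho - rho *m H)
  | Diss L => fun rho => L *m rho *m adjmx L
                  - (2%:R^-1)%:C *: (adjmx L *m L *m rho + rho *m (adjmx L *m L))
  end.

Variable n : nat.
Variable lam : 'I_n -> R.
Variable T : 'I_n -> lterm.

Definition Lgen : superop := fun X => \sum_(k < n) (lam k)%:C *: lterm_op (T k) X.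
Definition Gamma : R := \sum_(k < n) lam k.
Definition Lambda (t : R) : superop := sexp (sscale t Lgen).
Definition qdrift (tau : R) : superop := fun X =>
  \sum_(k < n) (lam k / Gamma)%:C *: sexp (sscale tau (lterm_op (T k))) X.

End Defs.

(* Main.v *)
Require Import Defs.
From HB Require Import structures.
From mathcomp Require Import all_boot all_order all_algebra.
From mathcomp Require Import all_classical all_reals all_analysis.
From mathcomp Require Import complex mxtens.
From mathcomp Require Import spectral ring lra.
Import Order.TTheory GRing.Theory Num.Theory.
Local Open Scope ring_scope.

Set Implicit Arguments.
Unset Strict Implicit.
Unset Printing Implicit Defensive.

(* With tau = t/r and m = r Gamma, write Lambda(t) = exp(B)^m where
   B = tau * sum_k p_k L_k.  Both exp(B) and E = E(tau) are diamond-norm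
   contractions, so telescoping gives
   |exp(B)^m - E^m| <= m |exp(B) - E|.  They agree to first order, and each
   second-order remainder |exp(A) - 1 - A| is at most |A|^2/2; by Jensen
   |sum_k p_k L_k|^2 <= sum_k p_k |L_k|^2, so
   m |exp(B) - E| <= m tau^2 sum_k p_k |L_k|^2, which is the claim.

   Contractivity is obtained without complete positivity of the semigroup: for
   a Lindblad generator A, 1 + h A is a Kraus map up to O(h^2), hence has
   diamond norm 1 + O(h^2), and exp(A) is the limit of (1 + A/n)^n.  The Taylor
   remainder bound is proved on the powers (1 + A/n)^j as well.  The trace norm
   of X is the least total weight sum_i s_i of a decomposition
   X = sum_i s_i u_i v_i^* with s_i >= 0 and u_i, v_i in the unit ball. *)

(** * Adjoints and polar decomposition *)

Section Adjoint.
Local Open Scope complex_scope.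
Variable R : realType.
Local Notation C := R[i].
Implicit Types m n p : nat.

Lemma adjmxK m n (A : 'M[C]_(m, n)) : adjmx (adjmx A) = A.
Proof. by apply/matrixP => i j; rewrite !mxE conjCK. Qed.

Lemma adjmxM m n p (A : 'M[C]_(m, n)) (B : 'M[C]_(n, p)) :
  adjmx (A *m B) = adjmx B *m adjmx A.
Proof. by rewrite /adjmx map_mxM trmx_mul. Qed.

Lemma adjmxD m n (A B : 'M[C]_(m, n)) : adjmx (A + B) = adjmx A + adjmx B.
Proof. by rewrite /adjmx map_mxD linearD. Qed.

Lemma adjmxZ m n (c : C) (A : 'M[C]_(m, n)) :
  adjmx (c *: A) = Num.conj c *: adjmx A.
Proof. by rewrite /adjmx map_mxZ linearZ. Qed.

Lemma adjmx1 m : adjmx 1%:M = 1%:M :> 'M[C]_m.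
Proof. by rewrite /adjmx map_mx1 trmx1. Qed.

Lemma conj_real (x : R) : Num.conj x%:C = x%:C.
Proof. exact: conjc_real. Qed.

Definition sqn m (u : 'cV[C]_m) : R := complex.Re ((adjmx u *m u) 0 0).

Definition nsq (z : C) : R := complex.Re z ^+ 2 + complex.Im z ^+ 2.

Lemma nsqE (z : C) : (nsq z)%:C = Num.conj z * z.
Proof. by rewrite add_Re2_Im2 mulrC -normCK. Qed.

Lemma nsq_ge0 z : 0 <= nsq z.
Proof. by rewrite addr_ge0 ?sqr_ge0. Qed.

Lemma nsq_eq0 z : nsq z = 0 -> z = 0.
Proof.
case: z => a b /eqP; rewrite paddr_eq0 ?sqr_ge0 // !sqrf_eq0 /=.
by case/andP => /eqP -> /eqP ->.
Qed.

Lemma nsq_normc z : nsq z = Normc.normc z ^+ 2.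
Proof. by case: z => a b; rewrite /nsq /= sqr_sqrtr // addr_ge0 ?sqr_ge0. Qed.

Lemma dot_sqn m (u : 'cV[C]_m) :
  (adjmx u *m u) 0 0 = (\sum_i nsq (u i 0))%:C.
Proof. by rewrite mxE rmorph_sum /=; apply: eq_bigr => i _; rewrite nsqE !mxE. Qed.

Lemma sqnE m (u : 'cV[C]_m) : sqn u = \sum_i nsq (u i 0).
Proof. by rewrite /sqn dot_sqn. Qed.

Lemma ler_nsq_sqn m (u : 'cV[C]_m) i : nsq (u i 0) <= sqn u.
Proof.
by rewrite sqnE (bigD1 i) //= lerDl sumr_ge0 // => j _; exact: nsq_ge0.
Qed.

Lemma Re_sum (I : finType) (F : I -> C) :
  complex.Re (\sum_i F i) = \sum_i complex.Re (F i).
Proof. by apply: (big_morph (@complex.Re R)) => // -[? ?] [? ?]. Qed.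

(** Coordinatewise AM-GM. Unlike Cauchy-Schwarz, the bound is linear in the squared norms, so that
    it can later be summed over Kraus operators. *)
Lemma Re_dot_le m (u v : 'cV[C]_m) :
  complex.Re ((adjmx u *m v) 0 0) <= (sqn u + sqn v) / 2%:R.
Proof.
rewrite mxE Re_sum !sqnE -big_split mulr_suml /=.
apply: ler_sum => i _; rewrite !mxE /nsq.
case: (u i 0) (v i 0) => [a b] [c d] /=.
have := sqr_ge0 (a - c); have := sqr_ge0 (b - d); nra.
Qed.

(** The diagonal entries of Y^* Y are the squared norms of the columns of Y. *)
Lemma adj_mul_eq0 m n (Y : 'M[C]_(m, n)) : adjmx Y *m Y = 0 -> Y = 0.
Proof.
move=> h; apply/matrixP => i j; rewrite mxE; apply: nsq_eq0.
have : \sum_k nsq (Y k j) = 0.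
  apply: (@complexI R); rewrite rmorph_sum /=.
  transitivity ((adjmx Y *m Y) j j); last by rewrite h mxE.
  by rewrite mxE; apply: eq_bigr => k _; rewrite nsqE !mxE.
move/eqP; rewrite psumr_eq0; last by move=> k _; exact: nsq_ge0.
by move/allP/(_ i (mem_index_enum _))/eqP.
Qed.

Lemma sqn_isometry m n (P : 'M[C]_(m, n)) u :
  adjmx P *m P = 1%:M -> sqn (P *m u) = sqn u.
Proof. by move=> h; rewrite /sqn adjmxM mulmxA -(mulmxA _ _ P) h mulmx1. Qed.

(* Functional calculus in the eigenbasis formed by the rows of P. *)
Definition spec m (P : 'M[C]_m) (f : 'I_m -> R) : 'M[C]_m :=
  adjmx P *m diag_mx (\row_(i < m) (f i)%:C) *m P.

Lemma spec_adj m (P : 'M[C]_m) f : adjmx (spec P f) = spec P f.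
Proof.
rewrite /spec !adjmxM adjmxK mulmxA; congr (_ *m _ *m _).
apply/matrixP => i j; rewrite !mxE.
by have [->|/negbTE ne] := eqVneq i j; rewrite ?mulr1n ?conj_real ?mulr0n ?rmorph0.
Qed.

Lemma spec_mul m (P : 'M[C]_m) : P *m adjmx P = 1%:M -> forall f g,
  spec P f *m spec P g = spec P (fun i => f i * g i).
Proof.
move=> h f g; rewrite /spec !mulmxA -(mulmxA _ P (adjmx P)) h mulmx1.
congr (_ *m _); rewrite -mulmxA; congr (_ *m _).
rewrite mul_diag_mx; apply/matrixP => i j; rewrite !mxE.
by have [->|ne] := eqVneq i j; rewrite ?mulr1n ?mulr0n ?mulr0 // rmorphM.
Qed.

Lemma spec_cst1 m (P : 'M[C]_m) : adjmx P *m P = 1%:M -> spec P (fun=> 1) = 1%:M.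
Proof.
move=> h; rewrite /spec (_ : diag_mx _ = 1%:M) ?mulmx1 //.
by apply/matrixP => i j; rewrite !mxE rmorph1.
Qed.

Lemma specB m (P : 'M[C]_m) f g : spec P f - spec P g = spec P (fun i => f i - g i).
Proof.
rewrite /spec -mulmxBl -mulmxBr; congr (_ *m _ *m _); apply/matrixP => i j.
by rewrite !mxE -mulrnBl rmorphB.
Qed.

Lemma spec_form m (P : 'M[C]_m) f (u : 'cV[C]_m) :
  (adjmx u *m spec P f *m u) 0 0 = (\sum_i f i * nsq ((P *m u) i 0))%:C.
Proof.
rewrite /spec !mulmxA -adjmxM -(mulmxA _ P u) -mulmxA mul_diag_mx mxE rmorph_sum /=.
by apply: eq_bigr => i _; rewrite rmorphM /= nsqE !mxE /= mulrCA.
Qed.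

Lemma spec_tr m (P : 'M[C]_m) f : P *m adjmx P = 1%:M ->
  \tr (spec P f) = (\sum_i f i)%:C.
Proof.
move=> h; rewrite /spec mxtrace_mulC mulmxA h mul1mx mxtrace_diag rmorph_sum /=.
by apply: eq_bigr => i _; rewrite !mxE.
Qed.

Lemma spec_sum m (P : 'M[C]_m) f : spec P f =
  \sum_i (f i)%:C *: (col i (adjmx P) *m adjmx (col i (adjmx P))).
Proof.
apply/matrixP => k l; rewrite /spec mul_mx_diag !mxE summxE.
apply: eq_bigr => i _; rewrite !mxE big_ord1 !mxE conjCK.
by rewrite mulrA [in RHS](mulrC (f i)%:C).
Qed.

Lemma spec_psd m (P : 'M[C]_m) f : (forall i, 0 <= f i) -> psd (spec P f).
Proof.
move=> hf; split; first exact: spec_adj.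
move=> v; rewrite spec_form ler0c sumr_ge0 // => i _.
by rewrite mulr_ge0 ?nsq_ge0.
Qed.

Lemma psd_spectral m (A : 'M[C]_m) : psd A ->
  exists P f, [/\ P *m adjmx P = 1%:M, adjmx P *m P = 1%:M,
    forall i, 0 <= f i & A = spec P f].
Proof.
move=> [hA pA].
have tA (B : 'M[C]_m) : map_mx Num.conj B^T = adjmx B by rewrite /adjmx map_trmx.
have nA : A \is normalmx by apply/normalmxP; rewrite tA hA.
set P := spectralmx A.
have PP : P *m adjmx P = 1%:M.
  by rewrite -tA; apply/unitarymxP; exact: spectral_unitarymx.
have PP' : adjmx P *m P = 1%:M by exact: mulmx1C.
have /orthomx_spectralP AE := nA.
rewrite -/P invmx_unitary ?spectral_unitarymx // tA in AE.
set D := spectral_diag A in AE.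
(* Each eigenvalue is the value of the quadratic form of A at an eigenvector, so positivity of A
   makes it real and nonnegative. *)
have DE i : D 0 i = (adjmx (col i (adjmx P)) *m A *m col i (adjmx P)) 0 0.
  have -> : adjmx (col i (adjmx P)) = row i P.
    by apply/matrixP => k l; rewrite !mxE conjCK.
  rewrite colE rowE {1}AE !mulmxA -(mulmxA (delta_mx 0 i)) PP mulmx1.
  rewrite -2!(mulmxA (_ *m _)) (mulmxA P) PP mul1mx -rowE -colE.
  by rewrite !mxE eqxx mulr1n.
have D0 i : 0 <= D 0 i by rewrite DE pA.
exists P, (fun i => complex.Re (D 0 i)); split; [exact: PP|exact: PP'| |].
  by move=> i; rewrite -ler0c RRe_real // ger0_real.
rewrite {1}AE /spec; congr (_ *m diag_mx _ *m _).
by apply/matrixP => i j; rewrite !mxE RRe_real ?ord1 // ger0_real.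
Qed.

(** [psdsqrt] selects some positive square root, and 0 if there is none; the square roots of the
    eigenvalues provide one. *)
Lemma psdsqrtP m (A : 'M[C]_m) : psd A ->
  psd (psdsqrt A) /\ psdsqrt A *m psdsqrt A = A.
Proof.
move=> /psd_spectral[P [f [PP _ f0 AE]]].
apply: (@xgetPex _ 0 [set S : 'M[C]_m | psd S /\ S *m S = A]%classic).
exists (spec P (fun i => Num.sqrt (f i))); split.
  by apply: spec_psd => i; exact: sqrtr_ge0.
rewrite (spec_mul PP) AE; congr spec; apply/funext => i.
by rewrite -expr2 sqr_sqrtr.
Qed.

Lemma gram_psd m n (X : 'M[C]_(m, n)) : psd (adjmx X *m X).
Proof.
split; first by rewrite adjmxM adjmxK.
move=> v; rewrite mulmxA -adjmxM -mulmxA dot_sqn ler0c sumr_ge0 // => i _.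
exact: nsq_ge0.
Qed.

(** Polar decomposition, with S = |X| = [spec P f] and W = S^+ X^* for the pseudo-inverse S^+ of S.
    The f i are the singular values of X. *)
Lemma polar m (X : 'M[C]_m) : exists W P f,
  [/\ (forall i, 0 <= f i) /\ trnorm X = \sum_i f i, P *m adjmx P = 1%:M,
      W *m X = spec P f, X = adjmx W *m spec P f
    & forall u, sqn (adjmx W *m u) <= sqn u].
Proof.
have [pS SS] := psdsqrtP (gram_psd X).
have [P [f [PP PP' f0 SE]]] := psd_spectral pS.
rewrite SE (spec_mul PP) in SS.
(* Since 0^-1 = 0, inverting each eigenvalue gives the pseudo-inverse S^+. *)
pose W := spec P (fun i => (f i)^-1) *m adjmx X.
pose e i := if f i == 0 then 0 else 1 : R.
have aW : adjmx W = X *m spec P (fun i => (f i)^-1).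
  by rewrite adjmxM adjmxK spec_adj.
exists W, P, f; split; [split; first exact: f0|exact: PP| | |].
- by rewrite /trnorm SE (spec_tr _ PP).
- rewrite -mulmxA -SS (spec_mul PP); congr spec; apply/funext => i.
  by have [->|ne] := eqVneq (f i) 0; [rewrite !mulr0|rewrite mulKf].
(* X (1 - S^+ S) vanishes because its Gram matrix is (1 - S^+ S) S^2 (1 - S^+ S) = 0. *)
- rewrite aW -mulmxA (spec_mul PP); apply/eqP; rewrite -subr_eq0.
  rewrite -{1}(mulmx1 X) -(spec_cst1 PP') -mulmxBr specB; apply/eqP.
  apply: adj_mul_eq0; rewrite adjmxM spec_adj mulmxA -(mulmxA _ _ X) -SS.
  rewrite !(spec_mul PP) /spec (_ : diag_mx _ = 0) ?mulmx0 ?mul0mx //.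
  apply/matrixP => i j; rewrite !mxE.
  have [->|ne] := eqVneq (f i) 0; first by rewrite !(mulr0, mul0r) mul0rn.
  by rewrite mulVf // subrr !(mulr0, mul0r) mul0rn.
move=> u.
(* W W^* = S^+ S^2 S^+ is the projection onto the support of S, whence the contraction. *)
have WW : W *m adjmx W = spec P (fun i => (f i)^-1 * (f i * f i * (f i)^-1)).
  rewrite aW /W -mulmxA [adjmx X *m _]mulmxA -SS (spec_mul PP (fun i => f i * f i)).
  by rewrite (spec_mul PP).
rewrite /sqn adjmxM adjmxK mulmxA -[adjmx u *m W *m _]mulmxA WW.
rewrite spec_form /= -/(sqn u) -(sqn_isometry u PP') sqnE.
apply: ler_sum => i _; rewrite -[leRHS]mul1r ler_wpM2r ?nsq_ge0 //.
have [->|ne] := eqVneq (f i) 0; first by rewrite !(mulr0, mul0r) ler01.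
by rewrite mulrA mulKf // mulfV.
Qed.

End Adjoint.

(** * The trace norm *)

Section TraceNorm.
Local Open Scope complex_scope.
Variable R : realType.
Local Notation C := R[i].
Local Notation normc := Normc.normc.
Implicit Types m : nat.

Lemma normc_ge0 (z : C) : 0 <= normc z.
Proof. by case: z => a b; exact: sqrtr_ge0. Qed.

Lemma normc_real (x : R) : 0 <= x -> normc x%:C = x.
Proof. by move=> x0; rewrite /= expr0n addr0 sqrtr_sqr ger0_norm. Qed.

Lemma normc_sum (I : finType) (F : I -> C) :
  normc (\sum_i F i) <= \sum_i normc (F i).
Proof.
apply: (big_ind2 (fun a x => normc a <= x)) => [|a x b y ax ay|//].
  by rewrite Normc.normc0.
exact: le_trans (le_normcD a b) (lerD ax ay).
Qed.

(** A singular value decomposition: expand |X| in its eigenbasis e_i and set u_i = W^* e_i, v_i =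
    e_i. *)
Lemma trnorm_decomp m (X : 'M[C]_m) :
  exists (s : 'I_m -> R) (u v : 'I_m -> 'cV[C]_m),
  [/\ forall i, 0 <= s i, forall i, sqn (u i) <= 1, forall i, sqn (v i) <= 1,
      trnorm X = \sum_i s i & X = \sum_i (s i)%:C *: (u i *m adjmx (v i))].
Proof.
have [W [P [f [[f0 tX] PP _ XE Wle]]]] := polar X.
have v1 i : sqn (col i (adjmx P)) <= 1.
  rewrite colE sqn_isometry; last by rewrite adjmxK.
  rewrite sqnE (bigD1 i) //= big1 => [|j /negbTE ji]; rewrite !mxE ?ji /nsq /=.
    by rewrite eqxx /= expr1n expr0n !addr0.
  by rewrite expr0n addr0.
exists f, (fun i => adjmx W *m col i (adjmx P)), (fun i => col i (adjmx P)).
split; [exact: f0| |exact: v1|exact: tX|].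
  by move=> i; exact: le_trans (Wle _) (v1 i).
rewrite {1}XE spec_sum mulmx_sumr; apply: eq_bigr => i _.
by rewrite -scalemxAr mulmxA.
Qed.

(** By duality: the trace norm is Re tr(W X) with W^* a contraction, and the trace of W u v^* is the
    inner product of W^* v with u, to which AM-GM applies. *)
Lemma trnorm_le (I : finType) m (s : I -> R) (u v : I -> 'cV[C]_m) :
  (forall i, 0 <= s i) ->
  trnorm (\sum_i (s i)%:C *: (u i *m adjmx (v i))) <=
    \sum_i s i * ((sqn (u i) + sqn (v i)) / 2%:R).
Proof.
move=> s0; set X := \sum_i _.
have [W [P [f [[f0 ->] PP WX _ Wle]]]] := polar X.
rewrite -[X in X <= _]/(complex.Re (\sum_i f i)%:C) -(spec_tr _ PP) -WX.
have -> : \tr (W *m X) = \sum_i (s i)%:C * \tr (W *m (u i *m adjmx (v i))).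
  rewrite /X mulmx_sumr (raddf_sum (@mxtrace _ _)).
  by apply: eq_bigr => i _; rewrite -scalemxAr /= mxtraceZ.
rewrite Re_sum; apply: ler_sum => i _; rewrite mulmxA mxtrace_mulC.
have -> : \tr (adjmx (v i) *m (W *m u i)) =
    (adjmx (adjmx W *m v i) *m u i) 0 0.
  by rewrite /mxtrace big_ord1 adjmxM adjmxK mulmxA.
set z := (_ *m u i) 0 0; have -> : complex.Re ((s i)%:C * z) = s i * complex.Re z.
  by case: z => a b /=; rewrite mul0r subr0.
apply: ler_wpM2l => //; apply: le_trans (Re_dot_le _ _) _.
by rewrite ler_wpM2r ?invr_ge0 // addrC lerD2l.
Qed.

Lemma trnorm_le1 (I : finType) m (s : I -> R) (u v : I -> 'cV[C]_m) :
  (forall i, 0 <= s i) -> (forall i, sqn (u i) <= 1) ->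
  (forall i, sqn (v i) <= 1) ->
  trnorm (\sum_i (s i)%:C *: (u i *m adjmx (v i))) <= \sum_i s i.
Proof.
move=> s0 u1 v1; apply: le_trans (trnorm_le _ _ s0) _; apply: ler_sum => i _.
by rewrite ler_piMr //; have := u1 i; have := v1 i; lra.
Qed.

Lemma trnorm_ge0 m (X : 'M[C]_m) : 0 <= trnorm X.
Proof. by have [s [u [v [s0 _ _ -> _]]]] := trnorm_decomp X; exact: sumr_ge0. Qed.

(** Concatenating optimal decompositions of X and Y decomposes X + Y; the sum type indexes the
    result. *)
Lemma ler_trnormD m (X Y : 'M[C]_m) : trnorm (X + Y) <= trnorm X + trnorm Y.
Proof.
have [s [u [v [s0 u1 v1 -> XE]]]] := trnorm_decomp X.
have [s' [u' [v' [s0' u1' v1' -> YE]]]] := trnorm_decomp Y.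
pose c (T : Type) (a b : 'I_m -> T) (i : 'I_m + 'I_m) :=
  match i with inl i => a i | inr i => b i end.
have -> : X + Y = \sum_i (c _ s s' i)%:C *: (c _ u u' i *m adjmx (c _ v v' i)).
  by rewrite big_sumType /= -XE -YE.
have -> : \sum_i s i + \sum_i s' i = \sum_i c _ s s' i by rewrite big_sumType.
by apply: trnorm_le1 => -[].
Qed.

Lemma trnormZ m (a : R) (X : 'M[C]_m) :
  0 <= a -> trnorm (a%:C *: X) <= a * trnorm X.
Proof.
move=> a0; have [s [u [v [s0 u1 v1 -> XE]]]] := trnorm_decomp X.
rewrite mulr_sumr {1}XE scaler_sumr.
under eq_bigr => i _ do rewrite scalerA -rmorphM.
by apply: trnorm_le1 => // i; exact: mulr_ge0.
Qed.

Lemma sqnN m (u : 'cV[C]_m) : sqn (- u) = sqn u.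
Proof.
rewrite !sqnE; apply: eq_bigr => i _; rewrite mxE /nsq.
by case: (u i 0) => a b /=; rewrite !sqrrN.
Qed.

Lemma trnormN m (X : 'M[C]_m) : trnorm (- X) <= trnorm X.
Proof.
have [s [u [v [s0 u1 v1 -> XE]]]] := trnorm_decomp X.
rewrite {1}XE -sumrN; under eq_bigr => i _ do rewrite -scalerN -mulNmx.
by apply: trnorm_le1 => // i; rewrite sqnN.
Qed.

Lemma trnorm0 m : trnorm (0 : 'M[C]_m) = 0.
Proof.
apply/eqP; rewrite eq_le trnorm_ge0 andbT.
by have := @trnormZ m 0 0 (lexx _); rewrite mul0r scaler0.
Qed.

Lemma sqn_scale_delta m (z : C) (i : 'I_m) : sqn (z *: delta_mx i 0) = nsq z.
Proof.
rewrite sqnE (bigD1 i) //= big1 => [|j /negbTE ji]; rewrite !mxE.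
  by rewrite !eqxx mulr1 addr0.
by rewrite ji /= mulr0 /nsq /= expr0n addr0.
Qed.

Lemma trnorm_entries m (X : 'M[C]_m) :
  trnorm X <= \sum_i \sum_j normc (X i j).
Proof.
pose s (p : 'I_m * 'I_m) := normc (X p.1 p.2).
(* The phase of the entry goes into u. For a zero entry the quotient is 0, which is still in the
   unit ball. *)
pose u (p : 'I_m * 'I_m) : 'cV[C]_m :=
  (X p.1 p.2 / (s p)%:C) *: delta_mx p.1 0.
pose v (p : 'I_m * 'I_m) : 'cV[C]_m := 1 *: delta_mx p.2 0.
have nsq1 (z : C) : normc z <= 1 -> nsq z <= 1.
  by move=> h; rewrite nsq_normc expr_le1 ?normc_ge0.
have XE : X = \sum_p (s p)%:C *: (u p *m adjmx (v p)).
  rewrite {1}[X]matrix_sum_delta pair_big; apply: eq_bigr => -[i j] _ /=.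
  rewrite /u /v /= scale1r -scalemxAl scalerA.
  have -> : adjmx (delta_mx j 0 : 'cV[C]_m) = delta_mx 0 j.
    apply/matrixP => k l; rewrite !mxE ord1 eqxx andbT /=.
    by case: (l == j); rewrite ?rmorph1 ?rmorph0.
  rewrite mul_delta_mx /s /=; congr (_ *: _).
  have [/Normc.eq0_normc ->|n0] := eqVneq (normc (X i j)) 0.
    by rewrite mul0r mulr0.
  rewrite mulrCA divff ?mulr1 //; apply: contra n0 => /eqP.
  by move/(@complexI R) ->.
rewrite {1}XE pair_big; apply: trnorm_le1 => p; first exact: normc_ge0.
  rewrite sqn_scale_delta nsq1 // Normc.normcM Normc.normcV.
  rewrite normc_real ?normc_ge0 // -/(s p).
  by have [->|n0] := eqVneq (s p) 0; rewrite ?mul0r ?ler01 ?divff.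
by rewrite sqn_scale_delta nsq1 // Normc.normc1.
Qed.

(** Coordinates of vectors in the unit ball have modulus at most 1, so a term s_k u_k v_k^*
    contributes at most s_k to an entry. *)
Lemma entry_le_trnorm m (X : 'M[C]_m) i j : normc (X i j) <= trnorm X.
Proof.
have [s [u [v [s0 u1 v1 -> XE]]]] := trnorm_decomp X.
have le1 (w : 'cV[C]_m) k : sqn w <= 1 -> normc (w k 0) <= 1.
  move=> w1; rewrite -(@expr_le1 _ 2) ?normc_ge0 // -nsq_normc.
  exact: le_trans (ler_nsq_sqn w k) w1.
rewrite XE summxE; apply: le_trans (normc_sum _) _; apply: ler_sum => k _.
rewrite !mxE big_ord1 !mxE Normc.normcM normc_real // ler_piMr //.
rewrite Normc.normcM mulr_ile1 ?normc_ge0 ?le1 //.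
have -> : normc (Num.conj (v k j 0)) = normc (v k j 0).
  by case: (v k j 0) => a b /=; rewrite sqrrN.
exact: le1.
Qed.

(** Each rank-one term u v^* of X becomes a sum of rank-one terms built from K_j u and K_j v; the
    bound of [trnorm_le] splits into a sum over the K_j u and one over the K_j v, each at most b. *)
Lemma trnorm_kraus (J : finType) m (w : J -> R) (K : J -> 'M[C]_m) b X :
  (forall j, 0 <= w j) ->
  (forall u, sqn u <= 1 -> \sum_j w j * sqn (K j *m u) <= b) ->
  trnorm (\sum_j (w j)%:C *: (K j *m X *m adjmx (K j))) <= b * trnorm X.
Proof.
move=> w0 Kb; have [s [u [v [s0 u1 v1 -> XE]]]] := trnorm_decomp X.
pose s' (p : J * 'I_m) := w p.1 * s p.2.
pose u' (p : J * 'I_m) := K p.1 *m u p.2.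
pose v' (p : J * 'I_m) := K p.1 *m v p.2.
have -> : \sum_j (w j)%:C *: (K j *m X *m adjmx (K j)) =
    \sum_p (s' p)%:C *: (u' p *m adjmx (v' p)).
  rewrite -(pair_bigA _ (fun j i =>
    (s' (j, i))%:C *: (u' (j, i) *m adjmx (v' (j, i))))).
  apply: eq_bigr => j _; rewrite XE mulmx_sumr mulmx_suml scaler_sumr.
  apply: eq_bigr => i _; rewrite -scalemxAr -scalemxAl scalerA /s' /u' /v' /=.
  by rewrite adjmxM !mulmxA rmorphM.
apply: le_trans (trnorm_le _ _ _) _ => [p|]; first exact: mulr_ge0.
rewrite -(pair_bigA _ (fun j i =>
  s' (j, i) * ((sqn (u' (j, i)) + sqn (v' (j, i))) / 2%:R))).
rewrite exchange_big mulr_sumr; apply: ler_sum => i _ /=.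
have -> : \sum_j s' (j, i) * ((sqn (u' (j, i)) + sqn (v' (j, i))) / 2%:R) =
   s i * ((\sum_j w j * sqn (K j *m u i) + \sum_j w j * sqn (K j *m v i)) / 2%:R).
  rewrite -big_split /= mulr_suml mulr_sumr; apply: eq_bigr => j _.
  by rewrite /s' /u' /v' /=; ring.
rewrite mulrC; apply: ler_wpM2r => //.
by have := Kb _ (u1 i); have := Kb _ (v1 i); lra.
Qed.

Lemma trnorm_kraus1 m (B : 'M[C]_m) b X :
  (forall u, sqn u <= 1 -> sqn (B *m u) <= b) ->
  trnorm (B *m X *m adjmx B) <= b * trnorm X.
Proof.
move=> Bb; rewrite -[B *m X *m _]scale1r.
have := @trnorm_kraus unit m (fun=> 1) (fun=> B) b X.
rewrite big_const card_unit /= addr0; apply => // u u1.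
by rewrite big_const card_unit /= addr0 mul1r Bb.
Qed.

Lemma sqn_mul_bound m (B : 'M[C]_m) :
  exists2 b, 0 <= b & forall u, sqn u <= 1 -> sqn (B *m u) <= b.
Proof.
exists (\sum_i (\sum_j normc (B i j)) ^+ 2).
  by rewrite sumr_ge0 // => i _; exact: sqr_ge0.
move=> u u1; rewrite sqnE; apply: ler_sum => i _.
rewrite nsq_normc ler_sqr ?nnegrE ?normc_ge0 ?sumr_ge0 //; last first.
  by move=> j _; exact: normc_ge0.
rewrite mxE; apply: le_trans (normc_sum _) _; apply: ler_sum => j _.
rewrite Normc.normcM ler_piMr ?normc_ge0 // -(@expr_le1 _ 2) ?normc_ge0 //.
by rewrite -nsq_normc; exact: le_trans (ler_nsq_sqn u j) u1.
Qed.

(* To first order in h a Lindblad step is the Kraus map with operators 1 + h B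
   and sqrt h J, and the Kraus operators are normalised up to h^2 B^* B. *)
Lemma trnorm_lindblad m (B J : 'M[C]_m) : B + adjmx B + adjmx J *m J = 0 ->
  exists2 c, 0 <= c & forall h X, 0 <= h ->
  trnorm (X + h%:C *: (J *m X *m adjmx J + B *m X + X *m adjmx B)) <=
    (1 + c * h ^+ 2) * trnorm X.
Proof.
move=> BJ; have [b b0 Bb] := sqn_mul_bound B.
(* One b pays for the normalisation defect of the Kraus operators, the other for the subtracted term
   h^2 B X B^*. *)
exists (2%:R * b) => [|h X h0]; first by rewrite mulr_ge0.
pose K (j : bool) := if j then 1%:M + h%:C *: B else J.
pose w (j : bool) : R := if j then 1 else h.
have -> : X + h%:C *: (J *m X *m adjmx J + B *m X + X *m adjmx B) =
    \sum_j (w j)%:C *: (K j *m X *m adjmx (K j)) -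
    (h ^+ 2)%:C *: (B *m X *m adjmx B).
  have E (V : zmodType) (x a b' c d : V) :
      x + (a + b' + c) = x + b' + (c + d) + a - d.
    by rewrite (addrAC (x + b')) -(addrA (x + b' + a)) addrK !addrA (addrAC x a).
  rewrite big_bool /= scale1r adjmxD adjmx1 adjmxZ conj_real.
  rewrite (mulmxDl _ _ X) mul1mx mulmxDr mulmx1 mulmxDl.
  rewrite -!scalemxAl -!scalemxAr scalerA expr2 rmorphM.
  by rewrite !scalerDr; exact: E.
apply: le_trans (ler_trnormD _ _) _.
have h1 : trnorm (\sum_j (w j)%:C *: (K j *m X *m adjmx (K j))) <=
    (1 + b * h ^+ 2) * trnorm X.
  apply: trnorm_kraus => [[]|u u1]; rewrite /w //=.
  rewrite big_bool /= mul1r.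
  (* The terms of order h cancel: by [BJ], the contributions of B and B^* offset that of J^* J. *)
  have -> : sqn ((1%:M + h%:C *: B) *m u) + h * sqn (J *m u) =
      sqn u + h ^+ 2 * sqn (B *m u).
    apply: (@complexI R); rewrite !rmorphD !rmorphM /= !sqnE -!dot_sqn.
    rewrite !adjmxM adjmxD adjmx1 adjmxZ conj_real !mulmxA.
    have E : adjmx u *m (1%:M + h%:C *: adjmx B) *m (1%:M + h%:C *: B) *m u +
        h%:C *: (adjmx u *m adjmx J *m J *m u) =
        adjmx u *m u + (h%:C * h%:C) *: (adjmx u *m adjmx B *m B *m u).
      have -> : adjmx u *m adjmx J *m J *m u = - (adjmx u *m (B + adjmx B) *m u).
        rewrite -[_ *m J *m u]mulmxA -!mulmxA (mulmxA (adjmx J)).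
        move/eqP: BJ; rewrite addrC addr_eq0 => /eqP ->.
        by rewrite mulNmx mulmxN.
      rewrite -!mulmxA.
      rewrite mulmxDl !mul1mx -scalemxAl !mulmxDl !mul1mx !mulmxDr -!scalemxAl.
      have E (V : zmodType) (x p q z : V) : x + p + (q + z) - (p + q) = x + z.
        by rewrite (addrC q) (addrA _ z) (addrAC x) -(addrA _ p q) addrK.
      rewrite -!scalemxAr !mulmxDr -!scalemxAr scalerN !scalerDr scalerA.
      exact: E.
    have M00 (M N : 'M[C]_1) (a : C) : (M + a *: N) 0 0 = M 0 0 + a * N 0 0.
      by rewrite !mxE.
    by rewrite -M00 E M00.
  have := Bb _ u1; have := sqr_ge0 h; nra.
have h2 : trnorm (- ((h ^+ 2)%:C *: (B *m X *m adjmx B)))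
    <= h ^+ 2 * (b * trnorm X).
  apply: le_trans (trnormN _) _; apply: le_trans (trnormZ _ (sqr_ge0 _)) _.
  rewrite ler_wpM2l ?sqr_ge0 //; exact: trnorm_kraus1.
apply: le_trans (lerD h1 h2) _; rewrite le_eqVlt; apply/orP; left; apply/eqP.
by ring.
Qed.

End TraceNorm.

(** * Superoperators and the diamond norm *)

(* The infinitesimal form of contractivity: (1 + A/n)^n then has seminorm at most
   (1 + c/n^2)^n, which tends to 1. *)
Definition contractive_rate (R : realType) p (q : 'M[R[i]]_p -> R)
    (A : 'M[R[i]]_p) :=
  exists2 c, 0 <= c &
    forall h, 0 <= h -> q (1 + (h%:C)%C *: A) <= 1 + c * h ^+ 2.

Section Superoperators.
Local Open Scope complex_scope.
Variables (R : realType) (d : nat).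
Local Notation C := R[i].
Local Notation normc := Normc.normc.
Implicit Types (Phi Psi : superop R d) (X : 'M[C]_(d * d)) (M N : 'M[C]_(d * d)).

Definition blk X (c e : 'I_d) : 'M[C]_d :=
  \matrix_(i, j) X (mxtens_index (i, c)) (mxtens_index (j, e)).

(** In the sum defining [tens_id] only the matrix unit at (c, e) contributes here, so Phi acts block
    by block. *)
Lemma tens_idE Phi X i j c e :
  tens_id Phi X (mxtens_index (i, c)) (mxtens_index (j, e)) =
  Phi (blk X c e) i j.
Proof.
rewrite /tens_id summxE (bigD1 c) //= [X in _ + X]big1 => [|c' /negbTE c'c].
  rewrite addr0 summxE (bigD1 e) //= [X in _ + X]big1 => [|e' /negbTE e'e].
    by rewrite addr0 tensmxE !mxE !eqxx mulr1.
  by rewrite tensmxE !mxE [e == _]eq_sym e'e andbF mulr0.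
rewrite summxE big1 // => e' _.
by rewrite tensmxE !mxE [c == _]eq_sym c'c mulr0.
Qed.

Lemma tens_mxP X (Y : 'M[C]_(d * d)) :
  (forall i j c e, X (mxtens_index (i, c)) (mxtens_index (j, e)) =
     Y (mxtens_index (i, c)) (mxtens_index (j, e))) -> X = Y.
Proof.
move=> XY; apply/matrixP => k l.
by case: (mxtens_indexP k) => i c; case: (mxtens_indexP l) => j e; exact: XY.
Qed.

Lemma blk_tens_id Phi X c e : blk (tens_id Phi X) c e = Phi (blk X c e).
Proof. by apply/matrixP => i j; rewrite mxE tens_idE. Qed.

Lemma tens_id_comp Phi Psi X :
  tens_id (Phi \o Psi) X = tens_id Phi (tens_id Psi X).
Proof. by apply: tens_mxP => i j c e; rewrite !tens_idE blk_tens_id. Qed.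

Lemma tens_id_id X : tens_id id X = X.
Proof. by apply: tens_mxP => i j c e; rewrite tens_idE mxE. Qed.

Lemma tens_id_sandwich (A B : 'M[C]_d) X :
  tens_id (fun Y => A *m Y *m B) X = (A *t 1%:M) *m X *m (B *t 1%:M).
Proof.
rewrite -{2}[X]tens_id_id /tens_id mulmx_sumr mulmx_suml.
apply: eq_bigr => c _; rewrite mulmx_sumr mulmx_suml; apply: eq_bigr => e _.
by rewrite !tensmx_mul mul1mx mulmx1.
Qed.

Lemma tens11 : (1%:M : 'M[C]_d) *t (1%:M : 'M[C]_d) = 1%:M.
Proof.
apply: tens_mxP => i j c e; rewrite tensmxE !mxE.
rewrite (can_eq (@mxtens_indexK d d)) xpair_eqE.
by case: (i == j); case: (c == e); rewrite ?mulr0 ?mul0r ?mulr1.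
Qed.

Lemma tens_id_mull (A : 'M[C]_d) X :
  tens_id (fun Y => A *m Y) X = (A *t 1%:M) *m X.
Proof.
rewrite -[RHS]mulmx1 -tens11 -tens_id_sandwich; congr tens_id.
by apply/funext => Y; rewrite mulmx1.
Qed.

Lemma tens_id_mulr (A : 'M[C]_d) X :
  tens_id (fun Y => Y *m A) X = X *m (A *t 1%:M).
Proof.
rewrite -[X in RHS]mul1mx -tens11 -tens_id_sandwich; congr tens_id.
by apply/funext => Y; rewrite mul1mx.
Qed.

Lemma tens_idD Phi Psi X :
  tens_id (fun Y => Phi Y + Psi Y) X = tens_id Phi X + tens_id Psi X.
Proof. by apply: tens_mxP => i j c e; rewrite [RHS]mxE !tens_idE mxE. Qed.

Lemma tens_idZ a Phi X : tens_id (fun Y => a *: Phi Y) X = a *: tens_id Phi X.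
Proof. by apply: tens_mxP => i j c e; rewrite [RHS]mxE !tens_idE mxE. Qed.

(* The matrix acts on vectorised arguments from the right, so that products are
   composed in reverse order (see opmM). *)
Definition opm M : superop R d := fun Y => vec_mx (mxvec Y *m M).

Lemma opmD M N Y : opm (M + N) Y = opm M Y + opm N Y.
Proof. by rewrite /opm mulmxDr linearD. Qed.

Lemma opmZ a M Y : opm (a *: M) Y = a *: opm M Y.
Proof. by rewrite /opm -scalemxAr linearZ. Qed.

Lemma opmN M Y : opm (- M) Y = - opm M Y.
Proof. by rewrite /opm mulmxN linearN. Qed.

Lemma opm_sum (I : finType) (F : I -> 'M[C]_(d * d)) Y :
  opm (\sum_i F i) Y = \sum_i opm (F i) Y.
Proof. by rewrite /opm mulmx_sumr linear_sum. Qed.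

Lemma opm1 Y : opm 1 Y = Y.
Proof. by rewrite /opm mulmx1 mxvecK. Qed.

Lemma opmM M N Y : opm (M * N) Y = opm N (opm M Y).
Proof. by rewrite /opm vec_mxK mulmxA. Qed.

Lemma opmX M k Y : opm (M ^+ k) Y = iter k (opm M) Y.
Proof. by elim: k => [|k IH]; rewrite ?opm1 // exprSr opmM IH. Qed.

Lemma opm_argZ M a Y : opm M (a *: Y) = a *: opm M Y.
Proof. by rewrite /opm linearZ -scalemxAl linearZ. Qed.

Lemma tens_id_opmD M N X :
  tens_id (opm (M + N)) X = tens_id (opm M) X + tens_id (opm N) X.
Proof. by apply: tens_mxP => i j c e; rewrite mxE !tens_idE opmD mxE. Qed.

Lemma tens_id_opmZ a M X : tens_id (opm (a *: M)) X = a *: tens_id (opm M) X.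
Proof. by apply: tens_mxP => i j c e; rewrite mxE !tens_idE opmZ mxE. Qed.

Lemma tens_id_opmN M X : tens_id (opm (- M)) X = - tens_id (opm M) X.
Proof. by apply: tens_mxP => i j c e; rewrite mxE !tens_idE opmN mxE. Qed.

Lemma tens_id_opmM M N X :
  tens_id (opm (M * N)) X = tens_id (opm N) (tens_id (opm M) X).
Proof.
rewrite -tens_id_comp; apply: tens_mxP => i j c e.
by rewrite !tens_idE opmM.
Qed.

Lemma tens_id_opm1 X : tens_id (opm 1) X = X.
Proof. by apply: tens_mxP => i j c e; rewrite !tens_idE opm1 mxE. Qed.

Lemma tens_id_opm_argZ M a X : tens_id (opm M) (a *: X) = a *: tens_id (opm M) X.
Proof.
apply: tens_mxP => i j c e; rewrite mxE !tens_idE.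
rewrite (_ : blk (a *: X) c e = a *: blk X c e) ?opm_argZ ?mxE //.
by apply/matrixP => k l; rewrite !mxE.
Qed.

Definition entrynorm m n (A : 'M[C]_(m, n)) : R := \sum_i \sum_j normc (A i j).

Lemma entrynorm_ge0 m n (A : 'M[C]_(m, n)) : 0 <= entrynorm A.
Proof.
rewrite sumr_ge0 // => i _; rewrite sumr_ge0 // => j _; exact: normc_ge0.
Qed.

(** The supremum in [dnorm] takes a default value on unbounded sets, so boundedness must come first;
    bounding each of the (d^2)^2 entries is enough. *)
Lemma opm_bounded M X : trnorm (tens_id (opm M) X) <=
  (d * d * (d * d))%:R * entrynorm M * trnorm X.
Proof.
have entry k l : normc (tens_id (opm M) X k l) <= entrynorm M * trnorm X.
  case: (mxtens_indexP k) => i c; case: (mxtens_indexP l) => j e.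
  rewrite tens_idE /opm -mxvecE vec_mxK mxE.
  apply: le_trans (normc_sum _) _; rewrite /entrynorm mulr_suml.
  apply: ler_sum => a _; rewrite Normc.normcM mulrC.
  apply: ler_pM; rewrite ?normc_ge0 //.
    rewrite (bigD1 (mxvec_index i j)) //= lerDl sumr_ge0 // => b _.
    exact: normc_ge0.
  by case: (mxvec_indexP a) => a1 a2; rewrite mxvecE mxE entry_le_trnorm.
apply: le_trans (trnorm_entries _) _.
apply: (@le_trans _ _ (\sum_(i < d * d) \sum_(j < d * d) entrynorm M * trnorm X)).
  by apply: ler_sum => k _; apply: ler_sum => l _.
by rewrite !sumr_const !card_ord -mulrnA mulr_natl mulrnAl.
Qed.

(** * The diamond norm as a submultiplicative seminorm *)

Lemma dnorm_le Phi K : 0 <= K ->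
  (forall X, trnorm (tens_id Phi X) <= K * trnorm X) -> dnorm Phi <= K.
Proof.
move=> K0 PhiK; apply: ge_sup.
  by exists (trnorm (tens_id Phi 0)), 0 => //=; rewrite trnorm0 ler01.
move=> _ [X /= X1 <-]; apply: le_trans (PhiK X) _.
by rewrite ler_piMr.
Qed.

Definition opnorm M : R := dnorm (opm M).

Lemma trnorm_opm_le M X : trnorm (tens_id (opm M) X) <= opnorm M * trnorm X.
Proof.
have bd := opm_bounded M.
(* A matrix of trace norm 0 cannot be rescaled to norm 1; [opm_bounded] then forces its image to
   have trace norm 0 too. *)
have := trnorm_ge0 X; rewrite le_eqVlt => /orP[/eqP t0|t0].
  by rewrite -t0 mulr0; apply: le_trans (bd X) _; rewrite -t0 mulr0.
set t := trnorm X in t0 *.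
have X1 : trnorm ((t^-1)%:C *: X) <= 1.
  apply: le_trans (trnormZ _ _) _; first by rewrite invr_ge0 ltW.
  by rewrite mulVf // gt_eqF.
have {1}-> : X = t%:C *: ((t^-1)%:C *: X).
  by rewrite scalerA -rmorphM divff ?gt_eqF // rmorph1 scale1r.
rewrite tens_id_opm_argZ; apply: le_trans (trnormZ _ (ltW t0)) _.
rewrite mulrC ler_wpM2r ?(ltW t0) //; apply: ub_le_sup; last first.
  by exists ((t^-1)%:C *: X).
exists ((d * d * (d * d))%:R * entrynorm M) => _ [Y /= Y1 <-].
by apply: le_trans (bd Y) _; rewrite ler_piMr // mulr_ge0 ?entrynorm_ge0.
Qed.

Lemma opnorm_ge0 M : 0 <= opnorm M.
Proof.
have h := trnorm_opm_le M; rewrite leNgt; apply/negP => q0.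
suff : 0 <= opnorm M by rewrite leNgt q0.
apply: ub_le_sup.
  exists ((d * d * (d * d))%:R * entrynorm M) => _ [Y /= Y1 <-].
  apply: le_trans (opm_bounded M Y) _.
  by rewrite ler_piMr // mulr_ge0 ?entrynorm_ge0.
exists 0; first by rewrite /= trnorm0 ler01.
apply/eqP; rewrite eq_le trnorm_ge0 andbT; apply: le_trans (h 0) _.
by rewrite trnorm0 mulr0.
Qed.

Lemma opnorm_le_entrynorm M : opnorm M <= (d * d * (d * d))%:R * entrynorm M.
Proof.
by apply: dnorm_le (opm_bounded M); rewrite mulr_ge0 ?entrynorm_ge0.
Qed.

Lemma opnormD M N : opnorm (M + N) <= opnorm M + opnorm N.
Proof.
apply: dnorm_le => [|X]; first by rewrite addr_ge0 ?opnorm_ge0.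
rewrite tens_id_opmD mulrDl; apply: le_trans (ler_trnormD _ _) _.
by rewrite lerD ?trnorm_opm_le.
Qed.

Lemma opnormZ a M : 0 <= a -> opnorm (a%:C *: M) <= a * opnorm M.
Proof.
move=> a0; apply: dnorm_le => [|X]; first by rewrite mulr_ge0 ?opnorm_ge0.
rewrite tens_id_opmZ -mulrA; apply: le_trans (trnormZ _ a0) _.
by rewrite ler_wpM2l ?trnorm_opm_le.
Qed.

Lemma opnormN M : opnorm (- M) <= opnorm M.
Proof.
apply: dnorm_le => [|X]; first exact: opnorm_ge0.
by rewrite tens_id_opmN; apply: le_trans (trnormN _) (trnorm_opm_le _ _).
Qed.

Lemma opnormM M N : opnorm (M * N) <= opnorm M * opnorm N.
Proof.
apply: dnorm_le => [|X]; first by rewrite mulr_ge0 ?opnorm_ge0.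
rewrite tens_id_opmM; apply: le_trans (trnorm_opm_le _ _) _.
rewrite -[leRHS]mulrA [leRHS]mulrCA.
by apply: ler_wpM2l; [exact: opnorm_ge0|exact: trnorm_opm_le].
Qed.

Lemma opnorm1 : opnorm 1 <= 1.
Proof. by apply: dnorm_le => // X; rewrite tens_id_opm1 mul1r. Qed.

(** * Lindblad terms and their infinitesimal contractivity *)

Definition lterm_mx (T : lterm R d) : 'M[C]_(d * d) := lin_mx (lterm_op T).

(** A common Lindblad form: B = -iH, J = 0 for a Hamiltonian term and B = -L^* L/2, J = L for a
    dissipative one. The relation between B and J expresses trace preservation. *)
Lemma lterm_opE (T : lterm R d) : lterm_ok T -> exists B J : 'M[C]_d,
  B + adjmx B + adjmx J *m J = 0 /\
  forall Y, lterm_op T Y = J *m Y *m adjmx J + B *m Y + Y *m adjmx B.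
Proof.
case: T => [H hH|L _].
  have ciE : Num.conj (- 'i : C) = 'i.
    by apply/eqP; rewrite eq_complex /= oppr0 opprK !eqxx.
  exists (- 'i *: H), 0; rewrite adjmxZ hH ciE; split.
    by rewrite mulmx0 addr0 -scalerDl addNr scale0r.
  move=> Y /=; rewrite !mul0mx add0r scalerBr -scalemxAl -scalemxAr.
  by rewrite -[X in _ + X]scaleNr opprK.
exists (- (2%:R^-1)%:C *: (adjmx L *m L)), L.
have cE : Num.conj (- (2%:R^-1)%:C : C) = - (2%:R^-1)%:C.
  by rewrite rmorphN /= conj_real.
have -> : adjmx (- (2%:R^-1)%:C *: (adjmx L *m L)) =
    - (2%:R^-1)%:C *: (adjmx L *m L).
  by rewrite adjmxZ cE adjmxM adjmxK.
split=> [|Y /=].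
  rewrite -scalerDl -{2}[_ *m L]scale1r -scalerDl.
  have -> : - (2%:R^-1)%:C - (2%:R^-1)%:C + 1 = (- 2%:R^-1 - 2%:R^-1 + 1)%:C :> C.
    by rewrite !rmorphD !rmorphN rmorph1.
  by rewrite (_ : - 2%:R^-1 - 2%:R^-1 + 1 = 0 :> R) ?scale0r //; lra.
rewrite scalerDr opprD addrA -!scaleNr -scalemxAl -scalemxAr.
by rewrite !mulmxA.
Qed.

Lemma lterm_op_linear (T : lterm R d) : lterm_ok T -> linear (lterm_op T).
Proof.
move=> /lterm_opE[B [J [_ TE]]] a Y Z; rewrite !TE.
rewrite !mulmxDr !mulmxDl -!scalemxAr -!scalemxAl !scalerDr.
by rewrite [X in X + _ = _]addrACA [LHS]addrACA.
Qed.

Lemma opm_lterm T Y : lterm_ok T -> opm (lterm_mx T) Y = lterm_op T Y.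
Proof.
move=> /lterm_op_linear hT.
pose f : {linear 'M[C]_d -> 'M[C]_d} := HB.pack (lterm_op T)
  (GRing.isLinear.Build C 'M[C]_d 'M[C]_d *:%R (lterm_op T) hT).
by rewrite /opm /lterm_mx (mul_vec_lin f) mxvecK.
Qed.

(** Tensoring B and J with the identity preserves the Lindblad relation, so [trnorm_lindblad]
    applies on the tensor product space. *)
Lemma lterm_contractive_rate T : lterm_ok T -> contractive_rate opnorm (lterm_mx T).
Proof.
move=> okT; have [B [J [BJ TE]]] := lterm_opE okT.
have adjt (A : 'M[C]_d) : adjmx (A *t (1%:M : 'M[C]_d)) = adjmx A *t 1%:M.
  by rewrite /adjmx map_mxT trmx_tens map_mx1 trmx1.
have tD (A A' : 'M[C]_d) : (A + A') *t (1%:M : 'M[C]_d) = A *t 1%:M + A' *t 1%:M.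
  by apply/matrixP => i j; rewrite !mxE mulrDl.
have [|c c0 hc] := @trnorm_lindblad R _ (B *t (1%:M : 'M[C]_d)) (J *t 1%:M).
  by rewrite !adjt tensmx_mul mulmx1 -!tD BJ tens0mx.
exists c => // h h0; apply: dnorm_le => [|X].
  by rewrite addr_ge0 // mulr_ge0 ?sqr_ge0.
apply: le_trans (hc h X h0); rewrite le_eqVlt; apply/orP; left; apply/eqP.
congr trnorm; rewrite !adjt.
rewrite -tens_id_sandwich -tens_id_mull -tens_id_mulr -!tens_idD -tens_idZ.
rewrite -{2}[X]tens_id_id -tens_idD; congr tens_id; apply/funext => Y.
by rewrite opmD opm1 opmZ opm_lterm // TE.
Qed.

End Superoperators.

(** * Matrix exponentials *)

Section MatrixExponential.
Import numFieldNormedType.Exports.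
Local Open Scope complex_scope.
Local Open Scope classical_set_scope.
Variable R : realType.
Local Notation C := R[i].
Local Notation normc := Normc.normc.

Lemma entrynorm_entry m n (A : 'M[C]_(m, n)) i j : normc (A i j) <= entrynorm A.
Proof.
rewrite /entrynorm (bigD1 i) //= (bigD1 j) //= -addrA lerDl addr_ge0 //.
  by rewrite sumr_ge0 // => k _; exact: normc_ge0.
by rewrite sumr_ge0 // => k _; rewrite sumr_ge0 // => l _; exact: normc_ge0.
Qed.

Lemma entrynormM m n p (A : 'M[C]_(m, n)) (B : 'M[C]_(n, p)) :
  entrynorm (A *m B) <= entrynorm A * entrynorm B.
Proof.
rewrite {1 2}/entrynorm mulr_suml; apply: ler_sum => i _.
apply: (@le_trans _ _ (\sum_j \sum_k normc (A i k) * normc (B k j))).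
  apply: ler_sum => j _; rewrite mxE; apply: le_trans (normc_sum _) _.
  by apply: ler_sum => k _; rewrite Normc.normcM.
rewrite exchange_big mulr_suml /=; apply: ler_sum => k _.
rewrite -mulr_sumr ler_wpM2l ?normc_ge0 // /entrynorm [leRHS](bigD1 k) //= lerDl.
by rewrite sumr_ge0 // => l _; rewrite sumr_ge0 // => ? _; exact: normc_ge0.
Qed.

(** The factor [entrynorm 1] accounts for k = 0, since the entrywise norm of the identity is p
    rather than 1. *)
Lemma entrynormX p (M : 'M[C]_p) k :
  entrynorm (M ^+ k) <= entrynorm (1 : 'M[C]_p) * entrynorm M ^+ k.
Proof.
elim: k => [|k IH]; first by rewrite !expr0 mulr1.
rewrite !exprSr mulrA; apply: le_trans (entrynormM _ _) _.
by apply: ler_wpM2r => //; exact: entrynorm_ge0.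
Qed.

Definition exp_sum p (M : 'M[C]_p) N : 'M[C]_p :=
  \sum_(k < N) (k`!%:R)^-1 *: M ^+ k.

(** Limits are taken on the real and imaginary parts of each entry, which reduces convergence to
    real series. *)
Definition mexp p (M : 'M[C]_p) : 'M[C]_p := \matrix_(i, j)
  Complex (limn (fun N => complex.Re (exp_sum M N i j)))
          (limn (fun N => complex.Im (exp_sum M N i j))).

Lemma Re_le_normc (z : C) : `|complex.Re z| <= normc z.
Proof. by rewrite -lecR; exact: normc_ge_Re. Qed.

Lemma Im_le_normc (z : C) : `|complex.Im z| <= normc z.
Proof.
case: z => a b; rewrite /= -sqrtr_sqr ler_sqrt ?addr_ge0 ?sqr_ge0 //.
by rewrite lerDr sqr_ge0.
Qed.

Lemma normc_le_ReIm (z : C) : normc z <= `|complex.Re z| + `|complex.Im z|.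
Proof.
case: z => a b; rewrite /= -[leRHS]ger0_norm ?addr_ge0 // -sqrtr_sqr.
rewrite ler_sqrt ?sqr_ge0 // sqrrD !real_normK ?num_real //.
by rewrite lerD2r lerDl mulrn_wge0 // mulr_ge0.
Qed.

(** An additive f covers real and imaginary parts at once; the series is dominated by a multiple of
    the exponential series of [entrynorm M]. *)
Lemma exp_sum_proj_cvg p (M : 'M[C]_p) i j (f : C -> R) :
  {morph f : x y / x + y} -> f 0 = 0 -> (forall z, `|f z| <= normc z) ->
  cvgn (fun N => f (exp_sum M N i j)).
Proof.
move=> fD f0 fn.
pose u k := f ((k`!%:R)^-1 * (M ^+ k) i j).
have -> : (fun N => f (exp_sum M N i j)) = series u.
  apply/funext => N; rewrite /exp_sum summxE (big_morph f fD f0) seriesEnat /=.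
  by rewrite big_mkord; apply: eq_bigr => k _; rewrite mxE.
apply: normed_cvg.
pose K := entrynorm (1 : 'M[C]_p).
have K0 : 0 <= K by exact: entrynorm_ge0.
have M0 : 0 <= entrynorm M by exact: entrynorm_ge0.
apply: (@series_le_cvg _ _ ((K : R) *: (exp_coeff (entrynorm M) : R^nat))).
- by move=> n; exact: normr_ge0.
- by move=> n; rewrite mulr_ge0 // exp_coeff_ge0.
- move=> k; rewrite /u /=; apply: le_trans (fn _) _.
  rewrite Normc.normcM Normc.normcV.
  have -> : normc (k`!%:R : C) = k`!%:R.
    by rewrite -[k`!%:R](rmorph_nat (real_complex R)) normc_real.
  rewrite [leRHS](_ : _ = (k`!%:R)^-1 * (K * entrynorm M ^+ k)); last first.
    by rewrite exp_coeffE /= mulrCA.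
  rewrite ler_wpM2l ?invr_ge0 //.
  exact: le_trans (entrynorm_entry _ _ _) (entrynormX _ _).
by apply: (@is_cvg_seriesZ R); exact: is_cvg_series_exp_coeff.
Qed.

Lemma mexp_cvg p (M : 'M[C]_p) (e : R) : 0 < e ->
  \forall N \near \oo, forall ij : 'I_p * 'I_p,
    normc (exp_sum M N ij.1 ij.2 - mexp M ij.1 ij.2) <= e.
Proof.
move=> e0; apply: filter_forall => -[i j] /=.
have e2 : 0 < e / 2%:R by rewrite divr_gt0.
have cRe : cvgn (fun N => complex.Re (exp_sum M N i j)).
  by apply: exp_sum_proj_cvg => // [[? ?] [? ?]|z] //; exact: Re_le_normc.
have cIm : cvgn (fun N => complex.Im (exp_sum M N i j)).
  by apply: exp_sum_proj_cvg => // [[? ?] [? ?]|z] //; exact: Im_le_normc.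
have /cvgrPdist_le /(_ _ e2) hRe := cRe.
have /cvgrPdist_le /(_ _ e2) hIm := cIm.
near=> N; apply: le_trans (normc_le_ReIm _) _.
have h1 : `|complex.Re (exp_sum M N i j - mexp M i j)| <= e / 2%:R.
  rewrite mxE; near: N; apply: filterS hRe => N; rewrite distrC.
  by case: (exp_sum M N i j).
have h2 : `|complex.Im (exp_sum M N i j - mexp M i j)| <= e / 2%:R.
  rewrite mxE; near: N; apply: filterS hIm => N; rewrite distrC.
  by case: (exp_sum M N i j).
by apply: le_trans (lerD h1 h2) _; rewrite -splitr.
Unshelve. all: by end_near. Qed.

Lemma entrynorm_mexp_cvg p (M : 'M[C]_p) (e : R) : 0 < e ->
  \forall N \near \oo, entrynorm (mexp M - exp_sum M N) <= e.
Proof.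
(* The successor keeps the divisor positive when p = 0. *)
move=> e0; set k : R := (p * p).+1%:R.
have k0 : 0 < k by rewrite ltr0n.
have := @mexp_cvg p M (e / k) (divr_gt0 e0 k0); apply: filterS => N hN.
apply: (@le_trans _ _ (\sum_(i < p) \sum_(j < p) e / k)).
  apply: ler_sum => i _; apply: ler_sum => j _; rewrite !mxE -normcN opprB.
  by have := hN (i, j); rewrite /= [mexp _ _ _]mxE.
rewrite !sumr_const !card_ord -mulrnA -mulr_natl mulrCA ler_piMr ?(ltW e0) //.
by rewrite ler_pdivrMr // mul1r ler_nat.
Qed.

(** Bridge from the topological limit in [sexp] to matrices: exponentials of superoperators can now
    be handled in the matrix ring. *)
Lemma sexp_opm (d : nat) (M : 'M[C]_(d * d)) : sexp (opm M) = opm (mexp M).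
Proof.
pose V : normedModType (C : numFieldType) := 'M[C : numFieldType]_d.
apply/funext => X.
apply: (@cvg_lim V (@norm_hausdorff _ V) _ \oo _
  (fun N => \sum_(k < N) (k`!%:R)^-1 *: iter k (opm M) X : V)).
have SE N : \sum_(k < N) (k`!%:R)^-1 *: iter k (opm M) X = opm (exp_sum M N) X.
  by rewrite opm_sum; apply: eq_bigr => k _; rewrite opmZ opmX.
apply/cvg_ballP => e e0; set K := entrynorm (mxvec X) + 1.
have K0 : 0 < K by rewrite ltr_wpDl ?ltr01 ?entrynorm_ge0.
(* The radius of a ball is a complex number, and its positivity makes it real. *)
have eE : e = (complex.Re e)%:C by rewrite RRe_real // gtr0_real.
have re0 : 0 < complex.Re e by rewrite -ltcR -eE.
have := entrynorm_mexp_cvg M (divr_gt0 re0 (mulr_gt0 K0 (ltr0Sn R 1))).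
apply: filterS => N hN; rewrite SE; split => // i j.
rewrite -ball_normE /= eE -[`|_|]/((normc _)%:C) ltcR.
apply: le_lt_trans (_ : _ <= K * entrynorm (mexp M - exp_sum M N)) _.
  have -> : opm (mexp M) X i j - opm (exp_sum M N) X i j =
      opm (mexp M - exp_sum M N) X i j by rewrite opmD opmN !mxE.
  rewrite /opm -mxvecE vec_mxK; apply: le_trans (entrynorm_entry _ _ _) _.
  apply: le_trans (entrynormM _ _) _; rewrite ler_wpM2r ?entrynorm_ge0 //.
  by rewrite lerDl.
apply: le_lt_trans (ler_wpM2l (ltW K0) hN) _.
have -> : K * (complex.Re e / (K * 2%:R)) = complex.Re e / 2%:R.
  by field; rewrite gt_eqF.
by lra.
Qed.

End MatrixExponential.

(** * Scalar estimates for Euler's formula (1 + a/n)^n *)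

Section RealEstimates.
Import numFieldNormedType.Exports.
Local Open Scope classical_set_scope.
Variable R : realType.

Lemma exp_coeff_sum_le (a : R) N : 0 <= a ->
  \sum_(k < N) (k`!%:R)^-1 * a ^+ k <= expR a.
Proof.
move=> a0.
have -> : \sum_(k < N) (k`!%:R)^-1 * a ^+ k = series (exp_coeff a) N.
  by rewrite seriesEnat /= big_mkord; apply: eq_bigr => k _; rewrite exp_coeffE.
apply: nondecreasing_cvgn_le; last exact: is_cvg_series_exp_coeff.
by apply: nondecreasing_series => n _ _; exact: exp_coeff_ge0.
Qed.

(** The product of the binomial coefficient and k! is a falling factorial with k factors, each at
    most n. *)
Lemma bin_div_le n k : (0 < n)%N -> 'C(n, k)%:R / n%:R ^+ k <= (k`!%:R)^-1 :> R.
Proof.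
move=> n0; have kf : 0 < k`!%:R :> R by rewrite ltr0n fact_gt0.
rewrite ler_pdivrMr ?exprn_gt0 ?ltr0n // mulrC ler_pdivlMr //.
rewrite -natrM -natrX ler_nat bin_ffact.
elim: k {kf} => [|k IH]; first by rewrite ffactn0.
by rewrite ffactnSr expnSr leq_mul // leq_subr.
Qed.

Lemma bernoulli_ineq (y : R) n : 0 <= y -> y <= 1 -> 1 - n%:R * y <= (1 - y) ^+ n.
Proof.
move=> y0 y1; elim: n => [|n IH]; first by rewrite mul0r subr0.
rewrite exprS; apply: le_trans (_ : (1 - y) * (1 - n%:R * y) <= _).
  by rewrite -addn1 natrD; have : 0 <= n%:R * y * y; [rewrite !mulr_ge0|lra].
by apply: ler_wpM2l => //; lra.
Qed.

(** With x = a/n, e^x (1 - x) <= 1 gives e^x (1 - x^2) <= 1 + x; take n-th powers and use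
    Bernoulli's inequality for (1 - x^2)^n. *)
Lemma expR_euler (a : R) n : 0 <= a -> (0 < n)%N ->
  expR a - (1 + a / n%:R) ^+ n <= expR a * a ^+ 2 / n%:R.
Proof.
move=> a0 n0; have n0' : 0 < n%:R :> R by rewrite ltr0n.
set x := a / n%:R; have x0 : 0 <= x by rewrite divr_ge0 // ltW.
have aE : a = n%:R * x by rewrite /x mulrCA divff ?mulr1 // gt_eqF.
have e0 := expR_gt0 a.
rewrite lerBlDl -lerBlDr.
have -> : expR a - expR a * a ^+ 2 / n%:R = expR a * (1 - n%:R * x ^+ 2).
  by rewrite {3}aE; field; rewrite gt_eqF.
have [x1|x1] := leP (x ^+ 2) 1; last first.
  apply: le_trans (_ : 0 <= _); last by rewrite exprn_ge0 // addr_ge0.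
  rewrite mulr_ge0_le0 ?(ltW e0) // subr_le0.
  have : 1 <= n%:R :> R by rewrite ler1n.
  by move=> h; apply: le_trans h _; rewrite ler_peMr ?(ltW n0') // ltW.
apply: le_trans (ler_wpM2l (ltW e0) (bernoulli_ineq n (sqr_ge0 _) x1)) _.
rewrite {1}aE expRM_natl -exprMn.
rewrite ler_pXn2r ?nnegrE ?mulr_ge0 ?subr_ge0 ?expR_ge0 ?addr_ge0 //.
have h1 : expR x * (1 - x) <= 1.
  rewrite -[leRHS](expRxMexpNx_1 x) ler_wpM2l ?expR_ge0 //.
  exact: expR_ge1Dx.
have -> : expR x * (1 - x ^+ 2) = (1 + x) * (expR x * (1 - x)) by ring.
by rewrite ler_piMr // addr_ge0.
Qed.

(** Letting n tend to infinity removes the discretisation error K/n and the excess growth e^(c/n) of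
    Euler steps. *)
Lemma euler_limit_le (x K c b : R) :
  (forall n, x <= K / n.+1%:R + expR (c / n.+1%:R) * b) -> x <= b.
Proof.
move=> xn.
pose f n := K * harmonic n + expR (c * harmonic n) * b.
have fb : f @ \oo --> K * 0 + expR (c * 0) * b.
  apply: cvgD; first by apply: cvgMr; exact: cvg_harmonic.
  apply: cvgMl; apply: continuous_cvg; first exact: continuous_expR.
  by apply: cvgMr; exact: cvg_harmonic.
rewrite !mulr0 expR0 add0r mul1r in fb.
by apply: (cvgr_to_ge fb); near=> n; exact: xn.
Unshelve. all: by end_near. Qed.

End RealEstimates.

(** * Contraction semigroups in a submultiplicative seminorm *)

Section Seminorm.
Import numFieldNormedType.Exports.
Local Open Scope complex_scope.
Variables (R : realType) (p : nat).
Local Notation C := R[i].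
Variables (q : 'M[C]_p -> R) (K : R).
Hypothesis qD : forall A B, q (A + B) <= q A + q B.
Hypothesis qZ : forall a A, 0 <= a -> q (a%:C *: A) <= a * q A.
Hypothesis qN : forall A, q (- A) <= q A.
Hypothesis qM : forall A B, q (A * B) <= q A * q B.
Hypothesis q1 : q 1 <= 1.
Hypothesis q_ge0 : forall A, 0 <= q A.
Hypothesis qK : forall A, q A <= K * entrynorm A.
Hypothesis K_ge0 : 0 <= K.
Implicit Types (A B U V : 'M[C]_p).

Lemma q_trans A B U : q (A - U) <= q (A - B) + q (B - U).
Proof. by rewrite -[X in q X](subrKA B) qD. Qed.

Lemma q_triangle A B : q A <= q (A - B) + q B.
Proof. by rewrite -[X in q X](subrK B) qD. Qed.

Lemma qBC A B : q (A - B) <= q (B - A).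
Proof. by rewrite -opprB qN. Qed.

Lemma qX A n : q (A ^+ n) <= q A ^+ n.
Proof.
elim: n => [|n IH]; first by rewrite !expr0.
by rewrite !exprSr; apply: le_trans (qM _ _) _; exact: ler_wpM2r.
Qed.

Lemma q_sum (I : finType) (c : I -> R) (F : I -> 'M[C]_p) :
  (forall i, 0 <= c i) ->
  q (\sum_i (c i)%:C *: F i) <= \sum_i c i * q (F i).
Proof.
move=> c0.
have q0 : q 0 <= 0 by have := @qZ 0 0 (lexx _); rewrite mul0r scaler0.
apply: (big_ind2 (fun A x => q A <= x)) => [//|A x B y Ax By|i _].
  exact: le_trans (qD _ _) (lerD Ax By).
exact: qZ.
Qed.

Definition euler_step n A : 'M[C]_p := (1 + (n%:R^-1)%:C *: A) ^+ n.

(* The coefficients 1/k! - 'C(n, k)/n^k of exp_sum A N - euler_step n A are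
   nonnegative, so their scalar counterpart bounds the seminorm. *)
Lemma exp_sum_euler A a n N : q A <= a -> (0 < n)%N -> (n < N)%N ->
  q (exp_sum A N - euler_step n A) <= expR a * a ^+ 2 / n%:R.
Proof.
move=> qa n0 nN; have a0 := le_trans (q_ge0 A) qa.
pose c k : R := (k`!%:R)^-1 - 'C(n, k)%:R / n%:R ^+ k.
have c0 k : 0 <= c k by rewrite subr_ge0 bin_div_le.
(* Binomial coefficients vanish beyond n, so the binomial expansion can be summed up to N as
   well. *)
have eE (T : nmodType) (F : nat -> T) : (forall k, (n < k)%N -> F k = 0) ->
    \sum_(k < n.+1) F k = \sum_(k < N) F k.
  move=> F0; rewrite (big_ord_widen N F nN) big_mkcond; apply: eq_bigr => k _.
  by case: ltnP => // /F0 ->.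
have EE : euler_step n A = \sum_(k < N) ('C(n, k)%:R / n%:R ^+ k : R)%:C *: A ^+ k.
  rewrite /euler_step addrC exprD1n.
  rewrite -(eE _ (fun k => ('C(n, k)%:R / n%:R ^+ k : R)%:C *: A ^+ k)); last first.
    by move=> k nk; rewrite bin_small // mul0r rmorph0 scale0r.
  apply: eq_bigr => k _.
  have -> : ((n%:R^-1 : R)%:C *: A) ^+ k = ((n%:R^-1 : R)%:C ^+ k) *: A ^+ k.
    elim: (k : nat) => [|l IH]; first by rewrite !expr0 scale1r.
    by rewrite !exprSr IH -[_ * _]/(_ *m _) -scalemxAl -scalemxAr scalerA.
  rewrite scalerMnl; congr (_ *: _).
  by rewrite -rmorphXn -rmorphMn /= exprVn -mulr_natl.
have -> : exp_sum A N - euler_step n A = \sum_(k < N) (c k)%:C *: A ^+ k.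
  rewrite EE /exp_sum -sumrB; apply: eq_bigr => k _.
  rewrite -scalerBl /c rmorphB; congr ((_ - _) *: _).
  by rewrite fmorphV rmorph_nat.
apply: le_trans (@q_sum 'I_N (fun k => c k) (fun k => A ^+ k) (fun k => c0 k)) _.
apply: le_trans (_ : \sum_(k < N) c k * a ^+ k <= _).
  apply: ler_sum => k _; apply: ler_wpM2l => //; apply: le_trans (qX _ _) _.
  by rewrite lerXn2r ?nnegrE.
apply: le_trans (expR_euler a0 n0).
under eq_bigr => k _ do rewrite mulrBl.
rewrite sumrB lerB ?exp_coeff_sum_le //.
rewrite le_eqVlt; apply/orP; left; apply/eqP.
rewrite addrC exprD1n.
rewrite -(eE _ (fun k => 'C(n, k)%:R / n%:R ^+ k * a ^+ k)); last first.
  by move=> k nk; rewrite bin_small // !mul0r.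
by apply: eq_bigr => k _; rewrite exprMn exprVn -mulr_natl; ring.
Qed.

(** The bound of [exp_sum_euler] is uniform in N > n, and [qK] makes the entrywise limit a limit for
    q. *)
Lemma mexp_euler A a n : q A <= a -> (0 < n)%N ->
  q (mexp A - euler_step n A) <= expR a * a ^+ 2 / n%:R.
Proof.
move=> qa n0; apply/ler_addgt0Pr => e e0.
have K1 : 0 < K + 1 by rewrite ltr_wpDl.
have [N0 _ hN] := entrynorm_mexp_cvg A (divr_gt0 e0 K1).
set N := maxn N0 n.+1.
apply: le_trans (q_trans _ (exp_sum A N) _) _; rewrite addrC.
apply: lerD; first by apply: exp_sum_euler => //; rewrite leq_maxr.
apply: le_trans (qK _) _.
apply: le_trans (ler_wpM2l K_ge0 (hN N _)) _; first by rewrite /= leq_maxl.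
by rewrite mulrCA ler_piMr ?(ltW e0) // ler_pdivrMr // mul1r lerDl.
Qed.

Lemma contractive_rateZ s A : 0 <= s ->
  contractive_rate q A -> contractive_rate q (s%:C *: A).
Proof.
move=> s0 [c c0 hc]; exists (c * s ^+ 2) => [|h h0].
  by rewrite mulr_ge0 ?sqr_ge0.
rewrite scalerA -rmorphM; apply: le_trans (hc _ (mulr_ge0 h0 s0)) _.
by rewrite exprMn mulrA mulrAC.
Qed.

(** As the weights sum to 1, adding 1 to h times the average of the A_i gives the average of the 1 +
    h A_i; the constants are averaged likewise. *)
Lemma contractive_rate_conv (I : finType) (w : I -> R) (A : I -> 'M[C]_p) :
  (forall i, 0 <= w i) -> \sum_i w i = 1 ->
  (forall i, contractive_rate q (A i)) ->
  contractive_rate q (\sum_i (w i)%:C *: A i).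
Proof.
move=> w0 w1 cA.
have /choice[c hc] i : exists c, 0 <= c /\ (forall h, 0 <= h ->
    q (1 + h%:C *: A i) <= 1 + c * h ^+ 2) by have [c] := cA i; exists c.
exists (\sum_i w i * c i) => [|h h0].
  by rewrite sumr_ge0 // => i _; rewrite mulr_ge0 //; have [] := hc i.
have -> : 1 + h%:C *: (\sum_i (w i)%:C *: A i) =
    \sum_i (w i)%:C *: (1 + h%:C *: A i).
  under [RHS]eq_bigr => i _ do rewrite scalerDr.
  rewrite big_split /= -scaler_suml -rmorph_sum /= w1 rmorph1 scale1r.
  rewrite scaler_sumr; congr (_ + _); apply: eq_bigr => i _.
  by rewrite !scalerA mulrC.
apply: le_trans (q_sum _ w0) _.
rewrite -[X in _ <= X + _]w1 mulr_suml -big_split /=; apply: ler_sum => i _.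
have [_ /(_ h h0)] := hc i; move/(ler_wpM2l (w0 i)) => /le_trans; apply.
by rewrite mulrDr mulr1 mulrA.
Qed.

(** With x = c/n^2, 1 + x <= e^x bounds the j-th power by e^(j x) <= e^(n x) = e^(c/n), uniformly in
    j <= n. *)
Lemma step_pow_le A c n j : 0 <= c -> (0 < n)%N -> (j <= n)%N ->
  q (1 + (n%:R^-1)%:C *: A) <= 1 + c * (n%:R^-1) ^+ 2 ->
  q ((1 + (n%:R^-1)%:C *: A) ^+ j) <= expR (c / n%:R).
Proof.
move=> c0 n0 jn h; apply: le_trans (qX _ _) _.
have n0' : 0 < n%:R :> R by rewrite ltr0n.
set x := c * (n%:R^-1) ^+ 2 in h.
have x0 : 0 <= x by rewrite mulr_ge0 ?sqr_ge0.
have -> : c / n%:R = n%:R * x by rewrite /x; field; rewrite gt_eqF.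
rewrite expRM_natl; apply: le_trans (_ : expR x ^+ j <= _).
  by rewrite lerXn2r ?nnegrE ?expR_ge0 //; apply: le_trans h (expR_ge1Dx _).
by rewrite ler_weXn2l // -expR0 ler_expR.
Qed.

Lemma mexp_contraction A : contractive_rate q A -> q (mexp A) <= 1.
Proof.
move=> [c c0 hc]; apply: (@euler_limit_le _ _ (expR (q A) * q A ^+ 2) c) => n.
apply: le_trans (q_triangle _ (euler_step n.+1 A)) _; rewrite mulr1.
apply: lerD; first exact: mexp_euler.
by apply: step_pow_le => //; apply: hc; rewrite invr_ge0.
Qed.

(** A discrete Taylor formula: with B = A/n, increments of (1 + B)^j are summed once in [F1] and
    again in [F2]. As all these powers are bounded by k = e^(c/n), no factor exponential in q A
    survives the limit. *)
Lemma mexp_taylor2 A : contractive_rate q A ->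
  q (mexp A - 1 - A) <= q A ^+ 2 / 2%:R.
Proof.
move=> [c c0 hc]; apply: (@euler_limit_le _ _ (expR (q A) * q A ^+ 2) c) => n.
set m := n.+1; have m0 : 0 < m%:R :> R by rewrite ltr0n.
set k := expR (c / m%:R); pose B := (m%:R^-1)%:C *: A.
have k0 : 0 <= k by exact: expR_ge0.
set b := q A / m%:R.
have b0 : 0 <= b by rewrite divr_ge0 // ltW.
have qB : q B <= b by rewrite /b mulrC; apply: qZ; rewrite invr_ge0 ltW.
have Fk j : (j <= m)%N -> q ((1 + B) ^+ j) <= k.
  by move=> jm; apply: step_pow_le => //; apply: hc; rewrite invr_ge0 ltW.
have F1 j : (j <= m)%N -> q ((1 + B) ^+ j - 1) <= j%:R * k * b.
  elim: j => [_|j IH jm].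
    rewrite expr0 subrr !mul0r.
    by have := @qZ 0 0 (lexx _); rewrite mul0r scaler0.
  have -> : (1 + B) ^+ j.+1 - 1 = ((1 + B) ^+ j - 1) + (1 + B) ^+ j * B.
    by rewrite exprSr mulrDr mulr1 addrAC.
  apply: le_trans (qD _ _) _; rewrite -addn1 natrD !mulrDl mul1r.
  apply: lerD; first exact: IH (ltnW jm).
  by apply: le_trans (qM _ _) _; apply: ler_pM => //; exact: Fk (ltnW jm).
have F2 j : (j <= m)%N ->
    q ((1 + B) ^+ j - 1 - j%:R%:C *: B) <= j%:R ^+ 2 / 2%:R * (k * b ^+ 2).
  elim: j => [_|j IH jm].
    rewrite expr0 subrr scale0r subrr expr0n !mul0r.
    by have := @qZ 0 0 (lexx _); rewrite mul0r scaler0.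
  have -> : (1 + B) ^+ j.+1 - 1 - j.+1%:R%:C *: B =
      ((1 + B) ^+ j - 1 - j%:R%:C *: B) + ((1 + B) ^+ j - 1) * B.
    rewrite exprSr mulrDr mulr1 mulrBl mul1r.
    rewrite -addn1 natrD rmorphD rmorph1 scalerDl scale1r.
    by rewrite opprD [X in X + _ = _]addrAC addrACA.
  apply: le_trans (qD _ _) _.
  apply: le_trans (lerD (IH (ltnW jm)) (qM _ _)) _.
  have h : q ((1 + B) ^+ j - 1) * q B <= j%:R * k * b * b.
    by apply: ler_pM => //; exact: F1 (ltnW jm).
  have kb : 0 <= k * b ^+ 2 by rewrite mulr_ge0 ?sqr_ge0.
  apply: le_trans (lerD (lexx _) h) _.
  (* The two sides differ by k b^2/2, since (j+1)^2/2 - j^2/2 = j + 1/2. *)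
  rewrite -subr_ge0 -addn1 natrD.
  rewrite (_ : _ - _ = k * b ^+ 2 / 2%:R) ?divr_ge0 //.
  by field.
apply: le_trans (_ : q (mexp A - euler_step m A) + q (euler_step m A - 1 - A) <= _).
  by rewrite -addrA -(addrA (euler_step m A)) -opprD; exact: q_trans.
apply: lerD; first exact: mexp_euler.
have := F2 m (leqnn m).
rewrite /B scalerA -rmorphM divff ?gt_eqF // rmorph1 scale1r.
move=> /le_trans; apply; rewrite le_eqVlt; apply/orP; left; apply/eqP.
by rewrite /b; field; rewrite gt_eqF.
Qed.

(** Telescoping. A bound k >= 1 leaves room for Euler steps, which are contractions only up to a
    factor e^(c/n). *)
Lemma q_pow_sub U V k m : 1 <= k -> q U <= k -> q V <= k ->
  q (U ^+ m - V ^+ m) <= m%:R * k ^+ m * q (U - V).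
Proof.
move=> k1 Uk Vk; have k0 : 0 <= k by exact: le_trans k1.
elim: m => [|m IH].
  rewrite !expr0 subrr !mul0r.
  by have := @qZ 0 0 (lexx _); rewrite mul0r scaler0.
have -> : U ^+ m.+1 - V ^+ m.+1 = U ^+ m * (U - V) + (U ^+ m - V ^+ m) * V.
  by rewrite !exprSr mulrBr mulrBl addrA subrK.
apply: le_trans (qD _ _) _.
have h1 : q (U ^+ m * (U - V)) <= k ^+ m.+1 * q (U - V).
  apply: le_trans (qM _ _) _; apply: ler_wpM2r => //.
  apply: le_trans (qX _ _) _; apply: le_trans (_ : k ^+ m <= _).
    by rewrite lerXn2r ?nnegrE.
  by rewrite ler_weXn2l.
have h2 : q ((U ^+ m - V ^+ m) * V) <= m%:R * k ^+ m * q (U - V) * k.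
  by apply: le_trans (qM _ _) _; apply: ler_pM.
apply: le_trans (lerD h1 h2) _; rewrite le_eqVlt; apply/orP; left; apply/eqP.
by rewrite -natr1 !exprSr; ring.
Qed.

(** The relation between exp(m B) and powers enters through Euler steps: (1 + B/N)^(N m)
    approximates exp(m B) and is the m-th power of an Euler step for B. Telescope this power against
    V^m and let N grow. *)
Lemma mexp_pow_sub B V m : contractive_rate q B -> q V <= 1 ->
  q (mexp (m%:R%:C *: B) - V ^+ m) <= m%:R * q (mexp B - V).
Proof.
case: m => [|m] cB qV.
  have -> : (0%:R : R)%:C *: B = 0 by rewrite scale0r.
  rewrite expr0 mul0r; have := @mexp_taylor2 0.
  have q0 : q 0 = 0.
    apply/eqP; rewrite eq_le q_ge0 andbT.
    by have := @qZ 0 0 (lexx _); rewrite mul0r scaler0.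
  rewrite q0 expr0n mul0r subr0; apply.
  by exists 0 => // h h0; rewrite scaler0 addr0 mul0r addr0.
have [c c0 hc] := cB.
set M := m.+1; set a := q (M%:R%:C *: B); set b := q B.
set K1 := expR a * a ^+ 2; set K2 := expR b * b ^+ 2.
have K20 : 0 <= K2 by rewrite mulr_ge0 ?expR_ge0 ?sqr_ge0.
have K10 : 0 <= K1 by rewrite mulr_ge0 ?expR_ge0 ?sqr_ge0.
apply: (@euler_limit_le _ _ (K1 + M%:R * expR (c * M%:R) * K2) (c * M%:R)) => n.
set N := n.+1; have N0 : 0 < N%:R :> R by rewrite ltr0n.
have GE : euler_step (N * M) (M%:R%:C *: B) = euler_step N B ^+ M.
  rewrite /euler_step -exprM scalerA -rmorphM natrM.
  rewrite (_ : (N%:R * M%:R)^-1 * M%:R = N%:R^-1 :> R) //.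
  by rewrite invfM mulfVK // pnatr_eq0.
have qG : q (euler_step N B) <= expR (c / N%:R).
  by apply: step_pow_le => //; apply: hc; rewrite invr_ge0 ltW.
have e1 : 1 <= expR (c / N%:R).
  by rewrite -expR0 ler_expR divr_ge0 // ltW.
apply: le_trans (q_trans _ (euler_step N B ^+ M) _) _.
have h1 : q (mexp (M%:R%:C *: B) - euler_step N B ^+ M) <= K1 / N%:R.
  rewrite -GE; apply: le_trans (mexp_euler (lexx _) _) _ => //.
  rewrite -/a -/K1 ler_wpM2l // lef_pV2 ?posrE ?ltr0n // ler_nat.
  by rewrite leq_pmulr.
have h2 := q_pow_sub M e1 qG (le_trans qV e1).
have eM : expR (c / N%:R) ^+ M = expR (c * M%:R / N%:R).
  by rewrite -expRM_natr; congr expR; ring.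
have h3 : q (euler_step N B - V) <= K2 / N%:R + q (mexp B - V).
  apply: le_trans (q_trans _ (mexp B) _) _; rewrite lerD2r.
  by apply: le_trans (qBC _ _) _; exact: mexp_euler.
(* [euler_limit_le] needs an error constant independent of n, so the exponential in front of K2/N is
   replaced by e^(c M). *)
have eM1 : expR (c * M%:R / N%:R) <= expR (c * M%:R).
  by rewrite ler_expR ler_pdivrMr // ler_peMr ?mulr_ge0 // ler1n.
rewrite eM in h2.
have E0 : 0 <= expR (c * M%:R / N%:R) by exact: expR_ge0.
have h4 := ler_wpM2l (mulr_ge0 (ler0n R M) E0) h3.
have h5 : M%:R * expR (c * M%:R / N%:R) * (K2 / N%:R) <=
    M%:R * expR (c * M%:R) * (K2 / N%:R).
  apply: ler_wpM2r; first by rewrite divr_ge0 // ltW.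
  by apply: ler_wpM2l.
apply: le_trans (lerD h1 (le_trans h2 h4)) _.
rewrite mulrDr addrA [X in _ <= X + _]mulrDl.
apply: lerD; last by rewrite le_eqVlt mulrCA mulrA eqxx.
by apply: lerD => //; rewrite -[leRHS]mulrA.
Qed.

(* Both exp B and the average of the exp (tau A_k) agree with 1 + B to first
   order, hence the two second-order remainders add up to the bound. *)
Lemma mexp_average (I : finType) (w : I -> R) (A : I -> 'M[C]_p) (tau : R) :
  (forall i, 0 <= w i) -> \sum_i w i = 1 -> 0 <= tau ->
  (forall i, contractive_rate q (A i)) ->
  q (mexp (tau%:C *: \sum_i (w i)%:C *: A i)
     - \sum_i (w i)%:C *: mexp (tau%:C *: A i)) <=
    tau ^+ 2 * \sum_i w i * q (A i) ^+ 2.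
Proof.
move=> w0 w1 t0 cA; set B := tau%:C *: _; set E := \sum_i _.
have cB : contractive_rate q B.
  by apply: contractive_rateZ => //; exact: contractive_rate_conv.
have h1 := mexp_taylor2 cB.
(* The weights sum to 1, so subtracting 1 and B from E averages the individual remainders. *)
have EB : E - 1 - B = \sum_i (w i)%:C *: (mexp (tau%:C *: A i) - 1 - tau%:C *: A i).
  under [RHS]eq_bigr => i _ do rewrite 2!scalerBr.
  rewrite sumrB sumrB -scaler_suml -rmorph_sum /= w1 rmorph1 scale1r.
  rewrite /B scaler_sumr; congr (_ - _); apply: eq_bigr => i _.
  by rewrite !scalerA mulrC.
have qtA i : q (tau%:C *: A i) <= tau * q (A i) by exact: qZ.
have h2 : q (E - 1 - B) <= tau ^+ 2 / 2%:R * \sum_i w i * q (A i) ^+ 2.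
  rewrite EB; apply: le_trans (q_sum _ w0) _; rewrite mulr_sumr.
  apply: ler_sum => i _; rewrite mulrCA; apply: ler_wpM2l => //.
  apply: le_trans (mexp_taylor2 (contractive_rateZ t0 (cA i))) _.
  rewrite [leRHS]mulrAC -[X in _ <= X / _]exprMn ler_wpM2r ?invr_ge0 //.
  by rewrite lerXn2r ?nnegrE ?mulr_ge0.
have qB : q B <= tau * \sum_i w i * q (A i).
  by apply: le_trans (qZ _ t0) _; apply: ler_wpM2l => //; exact: q_sum.
have jensen : (\sum_i w i * q (A i)) ^+ 2 <= \sum_i w i * q (A i) ^+ 2.
  set s := \sum_i w i * q (A i).
  (* Jensen's inequality follows from the nonnegativity of the weighted variance. *)
  have : 0 <= \sum_i w i * (q (A i) - s) ^+ 2.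
    by apply: sumr_ge0 => i _; rewrite mulr_ge0 ?sqr_ge0.
  have s1 : s * (2%:R * s) = \sum_i w i * q (A i) * (2%:R * s).
    by rewrite -mulr_suml.
  have s2 : s ^+ 2 = \sum_i w i * s ^+ 2 by rewrite -mulr_suml w1 mul1r.
  have -> : \sum_i w i * (q (A i) - s) ^+ 2 =
      \sum_i w i * q (A i) ^+ 2 - s * (2%:R * s) + s ^+ 2.
    rewrite s1 [X in _ = _ + X]s2 -sumrB -big_split /=.
    by apply: eq_bigr => i _; ring.
  by rewrite mulrCA -expr2; lra.
have qB2 : q B ^+ 2 <= tau ^+ 2 * \sum_i w i * q (A i) ^+ 2.
  apply: le_trans (_ : (tau * \sum_i w i * q (A i)) ^+ 2 <= _).
    rewrite lerXn2r ?nnegrE ?mulr_ge0 ?sumr_ge0 // => i _.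
    by rewrite mulr_ge0.
  by rewrite exprMn ler_wpM2l ?sqr_ge0.
have h3 : q (mexp B - E) <= q (mexp B - 1 - B) + q (E - 1 - B).
  have -> : mexp B - E = (mexp B - 1 - B) - (E - 1 - B).
    by rewrite opprB addrA subrK opprB addrA subrK.
  by apply: le_trans (qD _ _) _; rewrite lerD2l.
apply: le_trans h3 _; move: h1 h2 qB2; lra.
Qed.

End Seminorm.

(** * The qDRIFT error bound in diamond norm *)

Theorem theorem1 (R : realType) (d n : nat) (lam : 'I_n -> R)
    (T : 'I_n -> lterm R d)
    (Hlam : forall k, 0 <= lam k)
    (HT : forall k, lterm_ok (T k))
    (HGamma : 0 < Gamma lam)
    (t : R) (ht : 0 <= t) :
  (forall r m : nat, (0 < r)%N -> m%:R = r%:R * Gamma lam ->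
     dnorm (ssub (Lambda lam T t) (iter m (qdrift lam T (t / r%:R))))
       <= t ^+ 2 * (\sum_(k < n) lam k * dnorm (lterm_op (T k)) ^+ 2) / r%:R)
  /\
  (forall eps : R, 0 < eps ->
   forall r m : nat, (0 < r)%N -> m%:R = r%:R * Gamma lam ->
     Num.ceil (t ^+ 2 / eps * \sum_(k < n) lam k * dnorm (lterm_op (T k)) ^+ 2)
       <= r%:Z ->
     dnorm (ssub (Lambda lam T t) (iter m (qdrift lam T (t / r%:R)))) <= eps).
Proof.
set S := \sum_(k < n) lam k * dnorm (lterm_op (T k)) ^+ 2.
(* The threshold on r amounts to t^2 S / eps <= r, so the second claim follows from the first. *)
suff bound (r m : nat) : (0 < r)%N -> m%:R = r%:R * Gamma lam ->
    dnorm (ssub (Lambda lam T t) (iter m (qdrift lam T (t / r%:R)))) <=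
    t ^+ 2 * S / r%:R.
  split=> // eps e0 r m r0 mE; rewrite ceil_le_int => hr.
  apply: le_trans (bound r m r0 mE) _.
  rewrite ler_pdivrMr ?ltr0n // [leRHS]mulrC -ler_pdivrMr //.
  by rewrite mulrAC.
move=> r0 mE.
have r0' : 0 < r%:R :> R by rewrite ltr0n.
have G0 : Gamma lam != 0 by rewrite gt_eqF.
set tau := t / r%:R; have tau0 : 0 <= tau by rewrite divr_ge0 // ltW.
pose w k := lam k / Gamma lam.
have w0 k : 0 <= w k by rewrite divr_ge0 // ltW.
have w1 : \sum_k w k = 1 by rewrite -mulr_suml divff.
pose A k := lterm_mx (T k).
have AE k : lterm_op (T k) = opm (A k).
  by apply/funext => Y; rewrite opm_lterm.
pose c (x : R) : R[i] := real_complex R x.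
have scE s M : sscale s (opm M) = opm (c s *: M) :> superop R d.
  by apply/funext => Y; rewrite opmZ.
pose E := \sum_k c (w k) *: mexp (c tau *: A k).
have EE : qdrift lam T tau = opm E.
  apply/funext => Y; rewrite /qdrift opm_sum; apply: eq_bigr => k _.
  by rewrite AE scE sexp_opm opmZ.
pose B := c tau *: \sum_k c (w k) *: A k.
(* As m = r Gamma, m tau lam_k / Gamma = t lam_k, so m B is the matrix of t times the generator. *)
have LE : Lambda lam T t = opm (mexp (c m%:R *: B)).
  rewrite /Lambda -sexp_opm; congr sexp.
  have -> : Lgen lam T = opm (\sum_k c (lam k) *: A k).
    by apply/funext => Y; rewrite opm_sum; apply: eq_bigr => k _; rewrite opmZ AE.
  rewrite scE; congr opm; rewrite /B scalerA -rmorphM !scaler_sumr.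
  apply: eq_bigr => k _; rewrite !scalerA -!rmorphM; congr (real_complex R _ *: _).
  by rewrite mE /tau /w; field; rewrite G0 gt_eqF.
have -> : ssub (Lambda lam T t) (iter m (qdrift lam T tau)) =
    opm (mexp (c m%:R *: B) - E ^+ m).
  by apply/funext => Y; rewrite LE EE /ssub opmD opmN opmX.
have K0 : 0 <= (d * d * (d * d))%:R :> R by [].
have cA k : contractive_rate (@opnorm R d) (A k) by exact: lterm_contractive_rate.
have cB : contractive_rate (@opnorm R d) B.
  apply: (contractive_rateZ tau0).
  by apply: (contractive_rate_conv (@opnormD R d) (@opnormZ R d)).
(* The qDRIFT channel is a convex combination of contractions. *)
have qE : opnorm E <= 1.
  apply: le_trans (q_sum (@opnormD R d) (@opnormZ R d) _ w0) _.
  rewrite -w1; apply: ler_sum => k _; rewrite ler_piMr //.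
  apply: (mexp_contraction (@opnormD R d) (@opnormZ R d) (@opnormM R d)
    (@opnorm1 R d) (@opnorm_ge0 R d) (@opnorm_le_entrynorm R d) K0).
  exact: (contractive_rateZ tau0 (cA k)).
have := mexp_pow_sub (@opnormD R d) (@opnormZ R d) (@opnormN R d)
  (@opnormM R d) (@opnorm1 R d) (@opnorm_ge0 R d) (@opnorm_le_entrynorm R d) K0
  m cB qE.
move=> /le_trans; apply.
have := mexp_average (@opnormD R d) (@opnormZ R d) (@opnormN R d)
  (@opnormM R d) (@opnorm1 R d) (@opnorm_ge0 R d) (@opnorm_le_entrynorm R d) K0
  w0 w1 tau0 cA.
move=> /(ler_wpM2l (ler0n R m)) /le_trans; apply.
rewrite le_eqVlt; apply/orP; left; apply/eqP.
(* The normalisation cancels: m tau^2 = Gamma t^2 / r and Gamma w_k = lam_k. *)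
have -> : S = Gamma lam * \sum_k w k * opnorm (A k) ^+ 2.
  rewrite mulr_sumr; apply: eq_bigr => k _; rewrite /w AE.
  by rewrite mulrA [Gamma lam * _]mulrC divfK.
by rewrite mE /tau; field; rewrite gt_eqF.
Qed.
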